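(* Let $\epsilon \in (0,1)$. There is a multi-party communication protocol in the message passing model (on any connected graph $G$ with $m$ vertices, player $i$ holding $X_i \in \{0,1,\dots,M\}^n$, $\mathcal{X}=\sum_i X_i$) that outputs an $\epsilon$-additive approximation $\tilde{H}$ of the Shannon entropy $H$ of $\mathcal{X}$, i.e. $|\tilde{H}-H|\le \epsilon$. The protocol uses a max communication of $O\!\left(\frac{1}{\epsilon^2}(\log\log n + \log(1/\epsilon))\right)$ bits.
   Context: The (empirical) Shannon entropy of a nonzero $\mathcal{X} \in \mathbb{R}^n$ is $H = \sum_{i=1}^n p_i \log(1/p_i)$ where $p_i = |\mathcal{X}_i|/\|\mathcal{X}\|_1$ (terms with $p_i=0$ are $0$). Message passing model: there are $m$ players, one at each vertex of a connected undirected graph $G$ known to all players; player $i$ receives only its input $X_i$; a player may send a message only to a neighbor in $G$, received only by that neighbor; the players share a public random string; at termination a pre-specified player holds the output. Max communication is the maximum number of bits sent across any single edge. Standing assumption: $m, M = O(n^{c})$ for a constant $c$. *)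

(* Defs.v *)
From Stdlib Require Import Relations.
From HB Require Import structures.
From mathcomp Require Import all_boot all_order all_algebra.
From mathcomp Require Import boolp reals exp.

Set Implicit Arguments.
Unset Strict Implicit.
Unset Printing Implicit Defensive.

Import Order.TTheory GRing.Theory Num.Theory.

Local Open Scope ring_scope.

(* Natural logarithm.  A coordinate with p_i = 0 contributes 0 because of the
   factor p_i, whatever the value of [ln] there. *)
Definition shannon_entropy (R : realType) (n : nat) (x : 'rV[R]_n) : R :=
  let p i := `|x 0 i| / \sum_(j < n) `|x 0 j| in
  \sum_(i < n) p i * ln (1 / p i).

Definition connected_graph (V : finType) (e : rel V) : Prop :=
  [/\ symmetric e, irreflexive e & forall u v, connect e u v].

(* The behaviour of one player once its input and the public random string are
   fixed: a decision tree whose only information about the rest of the world is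
   the bits it reads.  [Send w b p] sends the bit [b] to [w]; [Recv w k] waits
   for the next bit from [w]; [Halt o] stops with output [o].  A longer message
   is a succession of bits, so that its framing is paid for.  There is no clock
   and no test for the absence of a message, so that nothing can be conveyed by
   timing or by silence. *)
Inductive program (V O : Type) : Type :=
  | Halt of O
  | Send of V & bool & program V O
  | Recv of V & (bool -> program V O).

Fixpoint neighborly (V : finType) (O : Type) (e : rel V) (u : V)
    (p : program V O) : Prop :=
  match p with
  | Halt _ => True
  | Send w _ p' => e u w /\ neighborly e u p'
  | Recv w k => e u w /\ forall b, neighborly e u (k b)
  end.

(* [I] is the type of the input of one player; [coins] is the length of the
   public random string, which is uniform. *)
Record protocol (V : finType) (e : rel V) (I O : Type) := Protocol {
  coins : nat;
  player : V -> I -> coins.-tuple bool -> program V O;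
  player_neighborly : forall u x r, neighborly e u (player u x r)
}.

(* [queue (u, w)] is the FIFO channel holding the bits sent by [u] to [w] and
   not yet read by [w]; [sent (u, w)] counts all bits ever sent by [u] to [w]. *)
Record config (V : finType) (O : Type) := Config {
  code : V -> program V O;
  queue : V * V -> seq bool;
  sent : V * V -> nat
}.

(* Asynchronous execution: any player that is able to act may act next. *)
Inductive step (V : finType) (O : Type) (c : config V O) : config V O -> Prop :=
  | step_send u w b p of code c u = Send w b p :
      step c (Config [eta code c with u |-> p]
                     [eta queue c with (u, w) |-> rcons (queue c (u, w)) b]
                     [eta sent c with (u, w) |-> (sent c (u, w)).+1])
  | step_recv u w k b s of code c u = Recv w k & queue c (w, u) = b :: s :
      step c (Config [eta code c with u |-> k b]
                     [eta queue c with (w, u) |-> s]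
                     (sent c)).

Definition terminal (V : finType) (O : Type) (c : config V O) : Prop :=
  forall c', ~ step c c'.

Definition all_halted (V : finType) (O : Type) (c : config V O) : Prop :=
  forall u, exists o, code c u = Halt V o.

Definition max_edge_bits (V : finType) (O : Type) (e : rel V)
    (c : config V O) : nat :=
  \max_(p : V * V | e p.1 p.2) (sent c p + sent c (p.2, p.1)).

Section Protocols.
Variables (V : finType) (e : rel V) (I O : Type) (P : protocol e I O).

Definition initial (X : V -> I) (r : (coins P).-tuple bool) : config V O :=
  Config (fun u => player u (X u) r) (fun _ => [::]) (fun _ => 0%N).

Definition reachable (X : V -> I) (r : (coins P).-tuple bool) :
    config V O -> Prop :=
  clos_refl_trans _ (@step V O) (initial X r).

(* Programs being well-founded, every execution is finite; what remains to be
   excluded is a deadlock. *)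
Definition terminates : Prop :=
  forall X r c, reachable X r c -> terminal c -> all_halted c.

Definition uses_max_communication (R : realType) (B : R) : Prop :=
  forall X r c, reachable X r c -> (max_edge_bits e c)%:R <= B.

Definition outputs_in (o : V) (X : V -> I) (good : O -> Prop)
    (r : (coins P).-tuple bool) : Prop :=
  forall c, reachable X r c -> terminal c ->
    exists2 y, code c o = Halt V y & good y.

Definition coin_probability (R : realType)
    (A : (coins P).-tuple bool -> Prop) : R :=
  #|[set r | `[< A r >]]|%:R / (2 ^ coins P)%:R.

End Protocols.

Definition aggregate (R : realType) (m n M : nat)
    (X : 'I_m -> {ffun 'I_n -> 'I_M.+1}) : 'rV[R]_n :=
  \row_j \sum_(i < m) (X i j)%:R.

(* Main.v *)
From Stdlib Require Import Relations.
Require Import Defs.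
From mathcomp Require Import all_boot all_order all_algebra.
From mathcomp Require Import boolp reals exp.
From mathcomp Require Import functions topology normedtype.
From mathcomp Require Import sequences derive realfun.
From mathcomp Require Import zify ring lra.

Set Implicit Arguments.
Unset Strict Implicit.
Unset Printing Implicit Defensive.

Import Order.TTheory GRing.Theory Num.Theory.
Import numFieldNormedType.Exports.

Local Open Scope ring_scope.

(** A token walks through the graph along a closed tour that starts and ends at
    the output player and uses each directed edge at most once (a depth-first
    traversal of a spanning tree), so each edge carries the token at most twice.
    The token holds [k + 1] positive counters, with [k] of order [1 / eps ^ 2]:
    the l1 norm [F] and [k] independent linear sketches
    [S = \sum_i x_i \sum_(l < L) V_(i, l)], where [V] is a heavy-tailed integer
    variable, [P (V >= v) ~ 1 / v].  Its Laplace transform satisfies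
    [ln E (exp (- s V)) = s (ln s - c) + o (s)] with an explicit constant [c], so
    [y = S / (L F)] satisfies [ln E (exp (- y)) = - H - ln L - c + o (1)], and
    [E (exp (- 2 y)) <= 8 (E (exp (- y))) ^ 2].  By Chebyshev's inequality the
    mean of [exp (- y)] over the [k] sketches determines [H].

    A counter is stored as a float with [O (ln ln n + ln (1 / eps))] bits, and
    every player that adds its share to it rounds the result randomly without
    bias.  Adding [s] to a representable number gives a remainder of at most [s],
    so one rounding adds at most [g * s * total] to the variance, [g] being the
    relative precision.  These contributions add up to [g * total ^ 2], whatever
    the length of the tour. *)

(** * Tours and asynchronous executions *)

Section TourExistence.
Local Open Scope nat_scope.
Variables (V : finType) (e : rel V).

Definition hops (u : V) (p : seq V) : seq (V * V) := pairmap pair u p.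

Lemma hops_cat u p1 p2 : hops u (p1 ++ p2) = hops u p1 ++ hops (last u p1) p2.
Proof. by rewrite /hops pairmap_cat. Qed.

Lemma mem_hops u p x y : (x, y) \in hops u p -> (x \in u :: p) /\ (y \in p).
Proof.
elim: p u => [|v p IH] u //=; rewrite in_cons => /orP[/eqP[-> ->]|/IH[hx hy]].
  by rewrite !mem_head.
by rewrite in_cons hx orbT in_cons hy orbT.
Qed.

(** The detour from [u] to [v] and back is spliced in at an occurrence of [u]. Both new directed
    edges have the end [v], which the tour did not visit, so no edge is repeated. *)
Lemma closed_tour_extend o p u v :
  u \in o :: p -> v \notin o :: p -> e u v -> e v u ->
  path e o p -> last o p = o -> uniq (hops o p) ->
  exists p', [/\ path e o p', last o p' = o, uniq (hops o p') &
    forall w, (w \in o :: p') = (w == v) || (w \in o :: p)].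
Proof.
move=> up vp euv evu; case/splitPl: up vp => p1 p2 lu vp pp lp up.
move: pp; rewrite cat_path lu => /andP[pp1 pp2].
exists (p1 ++ v :: u :: p2); split.
- by rewrite cat_path lu pp1 /= euv evu.
- by move: lp; rewrite !last_cat lu /=.
- have hv x y : (x, y) \in hops o (p1 ++ p2) -> (x != v) && (y != v).
    move=> /mem_hops[hx hy]; apply/andP; split; apply: contraNneq vp => <- //.
    by rewrite in_cons hy orbT.
  rewrite hops_cat lu /=.
  rewrite (@perm_uniq _ _ ([:: (u, v); (v, u)] ++ hops o (p1 ++ p2))); last first.
    by rewrite hops_cat lu perm_sym perm_catCA.
  have nuv : u != v by apply: contraNneq vp => <-; rewrite -lu -cat_cons mem_cat mem_last.
  rewrite cat_uniq up andbT; apply/andP; split.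
    by rewrite /= andbT inE xpair_eqE (negPf nuv).
  apply/hasPn => -[x y] /hv/andP[hx hy]; rewrite !inE !xpair_eqE negb_or.
  by rewrite (negPf hx) (negPf hy) andbF.
- move=> w; rewrite -!cat_cons !mem_cat [w \in v :: _]in_cons [w \in u :: _]in_cons.
  have -> : (w == u) = (w == u) && (w \in o :: p1).
    by case: eqP => // ->; rewrite -lu mem_last.
  by move: (w \in o :: p1) (w == v) (w == u) (w \in p2) => [] [] [] [].
Qed.

(** A path from [o] to a missed vertex leaves the visited set at some edge. *)
Lemma connected_boundary o (p : seq V) :
  (forall u v, connect e u v) -> ~~ [forall v, v \in o :: p] ->
  exists u v, [/\ u \in o :: p, v \notin o :: p & e u v].
Proof.
move=> con /forallPn[z zp].
have /connectP[q pq zq] := con o z.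
have: last o q \notin o :: p by rewrite -zq.
suff H u : u \in o :: p -> path e u q -> last u q \notin o :: p ->
  exists u v, [/\ u \in o :: p, v \notin o :: p & e u v] by exact: H (mem_head o p) pq.
elim: q {pq zq} u => [|y q IH] u up /=; first by rewrite up.
move=> /andP[euy pq] zl.
case: (boolP (y \in o :: p)) => yp; first exact: IH yp pq zl.
by exists u, y.
Qed.

Lemma closed_tour o : connected_graph e ->
  exists p, [/\ path e o p, last o p = o, uniq (hops o p) & forall v, v \in o :: p].
Proof.
move=> [sym irr con].
(* [k] is a lower bound on the number of visited vertices, raised by each detour; it cannot exceed
   [#|V|]. *)
suff H k : exists p, [/\ path e o p, last o p = o, uniq (hops o p) &
    (forall v, v \in o :: p) \/ k <= #|[set v in o :: p]|].
  have [p [h1 h2 h3 h4]] := H #|V|.+1; exists p; split => //.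
  by case: h4 => // /leq_trans /(_ (max_card _)); rewrite ltnn.
elim: k => [|k [p [h1 h2 h3 h4]]]; first by exists [::]; split => //; right.
case: (boolP [forall v, v \in o :: p]) => [/forallP a|na].
  by exists p; split => //; left.
have [u [v [up vp euv]]] := connected_boundary con na.
case: h4 => [a|h4]; first by rewrite a in vp.
have evu : e v u by rewrite sym.
have [p' [k1 k2 k3 k4]] := closed_tour_extend up vp euv evu h1 h2 h3.
exists p'; split => //; right; apply: leq_ltn_trans h4 _.
apply: proper_card; apply/properP; split.
  by apply/subsetP => w; rewrite !in_set k4 => ->; rewrite orbT.
by exists v; rewrite in_set ?k4 ?eqxx.
Qed.

End TourExistence.

(** * Confluence of asynchronous executions *)

Section Confluence.
Variables (V : finType) (O : Type).
Implicit Types c : config V O.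

Notation run := (clos_refl_trans (config V O) (@step V O)).

(** Executions indexed by their length, so that a run can be inverted at its first step. *)
Inductive runs : nat -> config V O -> config V O -> Prop :=
  | runs0 c : runs 0 c c
  | runsS k c1 c2 c3 of step c1 c2 & runs k c2 c3 : runs k.+1 c1 c3.

Lemma config_eq c c' : code c =1 code c' -> queue c =1 queue c' ->
  sent c =1 sent c' -> c = c'.
Proof.
by case: c c' => [a b d] [a' b' d'] /= /funext -> /funext -> /funext ->.
Qed.

Lemma runs_cat j k c1 c2 c3 : runs j c1 c2 -> runs k c2 c3 -> runs (j + k) c1 c3.
Proof. by elim=> // {}j d1 d2 d3 s _ IH /IH; exact: runsS. Qed.

Lemma run_runs c c' : run c c' <-> exists k, runs k c c'.
Proof.
split.
  elim=> [x y s|x|x y z _ [j hj] _ [k hk]].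
  - by exists 1%N; apply: runsS s _; exact: runs0.
  - by exists 0%N; exact: runs0.
  - by exists (j + k)%N; exact: runs_cat hj hk.
case=> k; elim=> [x|{}k x y z s _ IH]; first exact: rt_refl.
by apply: rt_trans IH; apply: rt_step.
Qed.

Definition push c u w b p : config V O :=
  Config [eta code c with u |-> p]
         [eta queue c with (u, w) |-> rcons (queue c (u, w)) b]
         [eta sent c with (u, w) |-> (sent c (u, w)).+1].

Definition pull c u w s p : config V O :=
  Config [eta code c with u |-> p] [eta queue c with (w, u) |-> s] (sent c).

Lemma step_push c u w b p : code c u = Send w b p -> step c (push c u w b p).
Proof. exact: step_send. Qed.

Lemma step_pull c u w k b s : code c u = Recv w k -> queue c (w, u) = b :: s ->
  step c (pull c u w s (k b)).
Proof. exact: step_recv. Qed.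

Lemma stepE c c' : step c c' ->
  (exists u w b p, code c u = Send w b p /\ c' = push c u w b p) \/
  (exists u w k b s, [/\ code c u = Recv w k, queue c (w, u) = b :: s &
     c' = pull c u w s (k b)]).
Proof.
by case=> [u w b p h|u w k b s h q]; [left|right]; [exists u, w, b, p|exists u, w, k, b, s].
Qed.

Lemma pushC c u w b p u' w' b' p' : u != u' ->
  push (push c u w b p) u' w' b' p' = push (push c u' w' b' p') u w b p.
Proof.
move=> uu; have uu' : u' != u by rewrite eq_sym.
apply: config_eq => [z|[x y]|[x y]] /=.
- by case: (eqVneq z u) => // ->; rewrite (negPf uu).
- rewrite !xpair_eqE (negPf uu) (negPf uu') /=.
  by case: (eqVneq x u) => //= ->; rewrite (negPf uu).
- rewrite !xpair_eqE (negPf uu) (negPf uu') /=.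
  by case: (eqVneq x u) => //= ->; rewrite (negPf uu).
Qed.

Lemma pullC c u w s p u' w' s' p' : u != u' ->
  pull (pull c u w s p) u' w' s' p' = pull (pull c u' w' s' p') u w s p.
Proof.
move=> uu; apply: config_eq => [z|[x y]|[x y]] //=.
- by case: (eqVneq z u) => // ->; rewrite (negPf uu).
- rewrite !xpair_eqE.
  by case: (eqVneq y u) => [->|_]; rewrite ?(negPf uu) !andbF.
Qed.

(** Sender and reader may share a channel. Reading takes the head of a nonempty queue and sending
    appends at its end, so the two still commute. *)
Lemma push_pullC c u w b p u' w' b' s' p' : u != u' ->
  queue c (w', u') = b' :: s' ->
  pull (push c u w b p) u' w'
    (behead (queue (push c u w b p) (w', u'))) p' =
  push (pull c u' w' s' p') u w b p.
Proof.
move=> uu q; apply: config_eq => z //=.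
  by case: (eqVneq z u) => // ->; rewrite (negPf uu).
have [->|n1] := eqVneq z (w', u').
  have [eq1|n2] := eqVneq (w', u') (u, w); last by rewrite q.
  by rewrite -eq1 ?eqxx q.
have [zu|//] := eqVneq z (u, w); rewrite zu in n1; by rewrite (negPf n1).
Qed.

(* Hence all executions end in the same configuration, and it is enough to
   exhibit one of them. *)
Lemma step_diamond c a b : step c a -> step c b ->
  a = b \/ exists2 d, step a d & step b d.
Proof.
(* By symmetry, the case where [a] is a read and [b] a send can be left out. *)
wlog: a b / (exists u w b p, code c u = Send w b p /\ a = push c u w b p) \/
   ~ (exists u w b' p, code c u = Send w b' p /\ b = push c u w b' p).
  move=> H ca cb; have [cas|[u [w [k [x [s [cu qu ea]]]]]]] := stepE ca.
    by apply: H => //; left.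
  have [cbs|nb] := stepE cb.
    have [->|[d bd ad]] := H b a (or_introl cbs) cb ca; first by left.
    by right; exists d.
  apply: H => //; right => -[u' [w' [b' [p' [h eb]]]]].
  move: nb => [u2 [w2 [k2 [b2 [s2 [h2 q2 eb2]]]]]].
  (* A send raises a counter and a read raises none, so [b] cannot be both. *)
  have : sent b (u', w') = sent b (u', w') by [].
  by rewrite {1}eb eb2 /= eqxx => /eqP; rewrite -[_.+1]addn1 -{2}[sent c _]addn0 eqn_add2l.
move=> D ca cb.
have [[u [w [x [p [cu ->]]]]]|[u [w [k [x [s [cu qu ea]]]]]]] := stepE ca.
  have [[u' [w' [x' [p' [cu' ->]]]]]|[u' [w' [k' [x' [s' [cu' qu' ->]]]]]]] := stepE cb.
    have [uu|uu] := eqVneq u u'.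
      by subst u'; move: cu'; rewrite cu => -[-> -> ->]; left.
    right; exists (push (push c u w x p) u' w' x' p').
      by apply: step_push; rewrite /= eq_sym (negPf uu).
    by rewrite pushC //; apply: step_push; rewrite /= (negPf uu).
  have [uu|uu] := eqVneq u u'; first by subst u'; move: cu'; rewrite cu.
  right; exists (push (pull c u' w' s' (k' x')) u w x p); last first.
    by apply: step_push; rewrite /= (negPf uu).
  rewrite -(push_pullC w x p (k' x') uu qu'); apply: step_pull.
    by rewrite /= eq_sym (negPf uu).
  by rewrite /=; case: eqP => [<-|_]; rewrite qu'.
have [[u' [w' [x' [p' [cu' eb]]]]]|[u' [w' [k' [x' [s' [cu' qu' ->]]]]]]] := stepE cb.
  case: D => [[u2 [w2 [b2 [p2 [h2]]]]]|]; last by case; exists u', w', x', p'.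
  rewrite ea => h; have : sent (pull c u w s (k x)) (u2, w2) = (sent c (u2, w2)).+1.
    by rewrite h /= eqxx.
  by move=> /= /eqP; rewrite -[_.+1]addn1 -{1}[sent c _]addn0 eqn_add2l.
have [uu|uu] := eqVneq u u'.
  subst u'; move: cu'; rewrite cu => -[e1 e2]; subst w' k'.
  by move: qu'; rewrite qu ea => -[-> ->]; left.
rewrite ea; right; exists (pull (pull c u w s (k x)) u' w' s' (k' x')).
  apply: step_pull; first by rewrite /= eq_sym (negPf uu).
  by rewrite /= xpair_eqE [u' == u]eq_sym (negPf uu) andbF.
rewrite pullC //; apply: step_pull; first by rewrite /= (negPf uu).
by rewrite /= xpair_eqE (negPf uu) andbF.
Qed.

(** By the diamond, the step either is the first one of the run to [t] or commutes past it. It is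
    absorbed before the end, since [t] has no successor. *)
Lemma step_runs_terminal k c c1 t : terminal t -> runs k c t -> step c c1 ->
  exists k', runs k' c1 t.
Proof.
move=> tt; elim: k c c1 => [|k IH] c c1 h s; inversion h; subst.
  by case: (tt _ s).
have [<-|[d ad bd]] := step_diamond H0 s; first by exists k.
have [k' dk'] := IH _ _ H1 ad.
by exists k'.+1; apply: runsS bd dk'.
Qed.

Lemma runs_terminal k c t j c' : terminal t -> runs k c t -> runs j c c' ->
  exists k', runs k' c' t.
Proof.
move=> tt + h; elim: h k => [{}c|{}j d1 d2 d3 s _ IH] k ct; first by exists k.
by have [k' ck'] := step_runs_terminal tt ct s; exact: IH ck'.
Qed.

(** Counters never decrease, so a bound at the final configuration covers all earlier ones. *)
Lemma runs_sent k c c' p : runs k c c' -> (sent c p <= sent c' p)%N.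
Proof.
elim=> // {}k d1 d2 d3 s _; apply: leq_trans.
by case: s => //= *; case: eqP => // ->.
Qed.

Lemma run_terminal c t c' : run c t -> terminal t -> run c c' -> run c' t.
Proof.
by move=> /run_runs[k ct] tt /run_runs[j cc]; apply/run_runs; exact: runs_terminal tt ct cc.
Qed.

Lemma run_sent c c' p : run c c' -> (sent c p <= sent c' p)%N.
Proof. by move=> /run_runs[k]; exact: runs_sent. Qed.

Lemma all_halted_terminal c : all_halted c -> terminal c.
Proof.
by move=> h c' [u w b p e|u w k b s e _]; have [o] := h u; rewrite e.
Qed.

Lemma terminal_run c c' : terminal c -> run c c' -> c' = c.
Proof. by move=> tc /run_runs[k h]; inversion h; subst => //; case: (tc _ H). Qed.

End Confluence.

(** * Passing a token along a walk *)

Section TokenPassing.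
Local Open Scope nat_scope.
Variables (V : finType) (e : rel V) (O : Type) (B : nat).
Hypothesis irr : irreflexive e.
Notation token := (B.-tuple bool).

Fixpoint send_bits (w : V) (s : seq bool) (p : program V O) : program V O :=
  if s is b :: s' then Send w b (send_bits w s' p) else p.

(** The number of bits to read is fixed in advance, so no delimiter is sent; [acc] collects the bits
    in order of arrival. *)
Fixpoint recv_bits (w : V) (i : nat) (acc : seq bool) (k : seq bool -> program V O) :
    program V O :=
  if i is i'.+1 then Recv w (fun b => recv_bits w i' (rcons acc b) k) else k acc.

(* [h] is [Some t] when the player at hand is [cur], which has just turned the
   token into [t]; [upd j] is what this player does with the token on receiving
   it at the [j]-th stop of the tour. *)
Fixpoint stroll (upd : nat -> token -> token) (t0 : token) (out : token -> O)
    (u : V) (cur : V) (h : option token) (rest : seq V) (j : nat) : program V O :=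
  match rest with
  | [::] => Halt V (out (odflt t0 h))
  | w :: rest' =>
      if h is Some t then send_bits w t (stroll upd t0 out u w None rest' j.+1)
      else if w == u then
        recv_bits cur B [::] (fun s =>
          stroll upd t0 out u w (Some (upd j (insubd t0 s))) rest' j.+1)
      else stroll upd t0 out u w None rest' j.+1
  end.

Lemma neighborly_send_bits u w s p : e u w -> neighborly e u p ->
  neighborly e u (send_bits w s p).
Proof. by move=> euw np; elim: s => //= b s IH; split. Qed.

Lemma neighborly_recv_bits u w i acc k : e u w ->
  (forall s, neighborly e u (k s)) -> neighborly e u (recv_bits w i acc k).
Proof. by move=> euw nk; elim: i acc => //= i IH acc; split. Qed.

Lemma neighborly_stroll upd t0 out u cur h rest j : symmetric e ->
  (isSome h -> cur = u) -> path e cur rest ->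
  neighborly e u (stroll upd t0 out u cur h rest j).
Proof.
move=> sym; elim: rest cur h j => [|w rest IH] cur h j //= hu /andP[ew pw].
case: h hu => [t|] hu; last case: eqP => [wu|_]; last exact: IH.
  by apply: neighborly_send_bits; [rewrite -hu|exact: IH].
subst w; apply: neighborly_recv_bits => [|s]; first by rewrite sym.
exact: IH.
Qed.

Notation run := (clos_refl_trans (config V O) (@step V O)).

Lemma run_send_bits c u w s p : code c u = send_bits w s p ->
  run c (Config [eta code c with u |-> p]
                [eta queue c with (u, w) |-> queue c (u, w) ++ s]
                [eta sent c with (u, w) |-> sent c (u, w) + size s]).
Proof.
elim: s c => [|b s IH] c /= cu.
  rewrite (_ : Config _ _ _ = c); first exact: rt_refl.
  apply: config_eq => z /=; case: eqP => // -> //; first by rewrite cats0.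
  by rewrite addn0.
apply: rt_trans (rt_step _ _ _ _ (step_push cu)) _.
have := IH (push c u w b (send_bits w s p)); rewrite /= eqxx => /(_ erefl).
rewrite (_ : Config _ _ _ = Config [eta code c with u |-> p]
                [eta queue c with (u, w) |-> queue c (u, w) ++ b :: s]
                [eta sent c with (u, w) |-> sent c (u, w) + (size s).+1]) //.
apply: config_eq => z /=; first by case: (z == u).
  by rewrite eqxx cat_rcons; case: (z == _).
by rewrite eqxx addnS addSn; case: (z == _).
Qed.

Lemma run_recv_bits c u w s acc k q :
  code c u = recv_bits w (size s) acc k -> queue c (w, u) = s ++ q ->
  run c (Config [eta code c with u |-> k (acc ++ s)]
                [eta queue c with (w, u) |-> q] (sent c)).
Proof.
elim: s c acc => [|b s IH] c acc /= cu qu.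
  rewrite (_ : Config _ _ _ = c); first exact: rt_refl.
  apply: config_eq => z //=; first by have [->|//] := eqVneq z u; rewrite cats0.
  by have [->|//] := eqVneq z (w, u); rewrite qu.
apply: rt_trans (rt_step _ _ _ _ (step_pull cu qu)) _.
set c1 := pull _ _ _ _ _.
have := IH c1 (rcons acc b); rewrite /= eqxx => /(_ erefl); rewrite eqxx => /(_ erefl).
rewrite (_ : Config _ _ _ = Config [eta code c with u |-> k (acc ++ b :: s)]
                [eta queue c with (w, u) |-> q] (sent c)) //.
by apply: config_eq => z //=; [rewrite cat_rcons; case: (z == u)|case: (z == (w, u))].
Qed.

Section Run.
Variables (upd : V -> nat -> token -> token) (t0 : token) (out : token -> O).

(** The remaining program of player [u] when [cur] holds [t]: the invariant carried along the tour
    by [run_stroll]. *)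
Definition stage cur t rest j (u : V) :=
  stroll (upd u) t0 out u cur (if u == cur then Some t else None) rest j.

Fixpoint tour_token (rest : seq V) (j : nat) (t : token) : token :=
  if rest is w :: rest' then tour_token rest' j.+1 (upd w j t) else t.

(** One schedule is exhibited: the holder sends the whole token, then the next stop reads it. The
    queues are empty again after each hop, and a hop costs [B] bits on its directed edge. *)
Lemma run_stroll cur t rest j c : path e cur rest ->
  code c =1 stage cur t rest j -> queue c =1 (fun=> [::]) ->
  exists c', [/\ run c c',
     code c' =1 stage (last cur rest) (tour_token rest j t) [::] (j + size rest) &
     forall p, sent c' p = sent c p + B * count_mem p (hops cur rest)].
Proof.
elim: rest cur t j c => [|w rest IH] cur t j c /=.
  by move=> _ cc qc; exists c; split; [exact: rt_refl|rewrite addn0|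
    move=> p; rewrite muln0 addn0].
move=> /andP[ew pw] cc qc.
have cw : w != cur by apply: contraTneq ew => ->; rewrite irr.
have s1 : code c cur = send_bits w t (stroll (upd cur) t0 out cur w None rest j.+1).
  by rewrite cc /stage eqxx.
have r1 := run_send_bits s1; set c1 := Config _ _ _ in r1.
have s2 : code c1 w = recv_bits cur (size t) [::] (fun s =>
    stroll (upd w) t0 out w w (Some (upd w j (insubd t0 s))) rest j.+1).
  by rewrite /= (negPf cw) cc /stage (negPf cw) /= eqxx size_tuple.
have q2 : queue c1 (cur, w) = t ++ [::] by rewrite /= eqxx qc cats0.
have r2 := run_recv_bits s2 q2; set c2 := Config _ _ _ in r2.
have [z|z|c' [r3 cc' sc']] := IH w (upd w j t) j.+1 c2 pw.
- rewrite /= /stage; have [->|zw] := eqVneq z w; first by rewrite valKd.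
  have [->//|zc] := eqVneq z cur.
  by rewrite cc /stage (negPf zc) /= eq_sym (negPf zw).
- rewrite /=; have [//|_] := eqVneq z (cur, w); exact: qc.
exists c'; split.
- by apply: rt_trans r1 _; apply: rt_trans r2 r3.
- by move=> z; rewrite cc' addSnnS.
- move=> p; rewrite sc' /= mulnDr addnA size_tuple eq_sym; congr (_ + _).
  by case: eqP => [->|_]; rewrite ?muln1 ?muln0 ?addn0.
Qed.

End Run.
End TokenPassing.

(** * The tour as a protocol *)

Section TourProtocol.
Local Open Scope nat_scope.
Variables (V : finType) (e : rel V) (I O : Type) (B cn : nat).
Variables (o : V) (p : seq V).
Hypothesis graph_e : connected_graph e.
Hypotheses (tour_path : path e o p) (tour_closed : last o p = o).
Hypothesis tour_uniq : uniq (hops o p).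
Variables (upd : I -> cn.-tuple bool -> V -> nat -> B.-tuple bool -> B.-tuple bool).
Variables (t0 : B.-tuple bool) (out : cn.-tuple bool -> B.-tuple bool -> O).

(** The output player is stop 0 and updates the initial token before sending anything, so the
    remaining stops are numbered from 1. *)
Definition tour_player (u : V) (x : I) (r : cn.-tuple bool) : program V O :=
  stroll (upd x r u) t0 (out r) u o
    (if u == o then Some (upd x r u 0 t0) else None) p 1.

Lemma tour_player_neighborly u x r : neighborly e u (tour_player u x r).
Proof.
have [sym irr _] := graph_e.
by apply: neighborly_stroll => //; case: eqP.
Qed.

Definition tour_protocol : protocol e I O := Protocol tour_player_neighborly.

Definition tour_result (X : V -> I) (r : cn.-tuple bool) : B.-tuple bool :=
  tour_token (fun u => upd (X u) r u) (o :: p) 0 t0.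

Lemma tour_run (X : V -> I) (r : cn.-tuple bool) :
  exists c, [/\ reachable (P := tour_protocol) X r c, all_halted c,
    code c o = Halt V (out r (tour_result X r)) &
    forall q, sent c q = B * count_mem q (hops o p)].
Proof.
have [sym irr _] := graph_e.
have [//|//|c [rc cc sc]] := @run_stroll V e O B irr (fun u => upd (X u) r u) t0 (out r) o
  (upd (X o) r o 0 t0) p 1 (initial (P := tour_protocol) X r) tour_path.
  by move=> u; rewrite /= /tour_player /stage; case: eqP => // ->.
exists c; split => //.
- by move=> u; rewrite cc /stage /=; eexists.
- by rewrite cc /stage tour_closed eqxx.
Qed.

(** By confluence, a terminal configuration can only be the final one of [tour_run], in which every
    player has halted. *)
Lemma tour_terminates : terminates tour_protocol.
Proof.
move=> X r c rc tc; have [t [rt ht _ _]] := tour_run X r.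
by rewrite -(terminal_run tc (run_terminal rt (all_halted_terminal ht) rc)).
Qed.

Lemma tour_outputs X r (good : O -> Prop) : good (out r (tour_result X r)) ->
  outputs_in (P := tour_protocol) o X good r.
Proof.
move=> g c rc tc; have [t [rt ht ct _]] := tour_run X r.
rewrite -(terminal_run tc (run_terminal rt (all_halted_terminal ht) rc)).
by exists (out r (tour_result X r)).
Qed.

(** No directed edge occurs twice among the hops, so each direction carries at most one token of [B]
    bits. *)
Lemma tour_communication X r c : reachable (P := tour_protocol) X r c ->
  max_edge_bits e c <= B.*2.
Proof.
move=> rc; have [t [rt ht _ st]] := tour_run X r.
have le1 q : sent c q <= B.
  apply: leq_trans (run_sent q (run_terminal rt (all_halted_terminal ht) rc)) _.
  by rewrite st count_uniq_mem // -[leqRHS]muln1 leq_mul2l; case: (_ \in _); rewrite orbT.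
by apply/bigmax_leqP => q _; rewrite -addnn leq_add.
Qed.

End TourProtocol.

(** * Averages over finite types *)

Section Average.
Variable R : realType.

(** Expectation under the uniform law. A product type models independent draws, and [{ffun I -> T}]
    an independent family indexed by [I]. *)
Definition avg (T : finType) (f : T -> R) : R := (\sum_t f t) / #|T|%:R.

Lemma eq_avg (T : finType) (f g : T -> R) : f =1 g -> avg f = avg g.
Proof. by move=> fg; congr (_ / _); apply: eq_bigr. Qed.

Lemma avg_cst (T : finType) (a : R) : (0 < #|T|)%N -> avg (fun _ : T => a) = a.
Proof.
by move=> T0; rewrite /avg sumr_const -[a *+ _]mulr_natr mulfK // pnatr_eq0 -lt0n.
Qed.

Lemma avgD (T : finType) (f g : T -> R) : avg (fun t => f t + g t) = avg f + avg g.
Proof. by rewrite /avg big_split mulrDl. Qed.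

Lemma avgZ (T : finType) a (f : T -> R) : avg (fun t => a * f t) = a * avg f.
Proof. by rewrite /avg -mulr_sumr mulrA. Qed.

Lemma avg_sum (T I : finType) (f : I -> T -> R) :
  avg (fun t => \sum_i f i t) = \sum_i avg (f i).
Proof. by rewrite /avg exchange_big mulr_suml. Qed.

Lemma le_avg (T : finType) (f g : T -> R) : (forall t, f t <= g t) -> avg f <= avg g.
Proof. by move=> fg; rewrite /avg ler_wpM2r ?invr_ge0 // ler_sum. Qed.

Lemma avg_pair (T U : finType) (f : T * U -> R) :
  avg f = avg (fun t => avg (fun u => f (t, u))).
Proof.
rewrite /avg card_prod natrM invfM mulrA mulrAC -mulr_suml; congr (_ / _ / _).
by rewrite pair_big; apply: eq_bigr => -[].
Qed.

Lemma avg_bij (T U : finType) (h : T -> U) (f : U -> R) :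
  bijective h -> avg (fun t => f (h t)) = avg f.
Proof.
move=> bh; rewrite /avg (bij_eq_card bh); congr (_ / _).
by rewrite [RHS](reindex h) //; exact: onW_bij.
Qed.

Lemma avg_fst (T U : finType) (f : T -> R) : (0 < #|U|)%N ->
  avg (fun w : T * U => f w.1) = avg f.
Proof. by move=> U0; rewrite avg_pair; apply: eq_avg => t /=; rewrite avg_cst. Qed.

Lemma avg_cons (T : finType) n (f : n.+1.-tuple T -> R) :
  avg f = avg (fun x => avg (fun t : n.-tuple T => f [tuple of x :: t])).
Proof.
rewrite -(avg_pair (fun w : T * n.-tuple T => f [tuple of w.1 :: w.2])).
rewrite -(@avg_bij _ _ (fun w : T * n.-tuple T => [tuple of w.1 :: w.2]) f) //.
exists (fun t : n.+1.-tuple T => (thead t, [tuple of behead t])) => [[x t]|t] /=.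
  by congr (_, _); apply/val_inj.
by rewrite [RHS]tuple_eta; apply/val_inj.
Qed.

Lemma avg_ffun_prod (I T : finType) (f : I -> T -> R) :
  avg (fun w : {ffun I -> T} => \prod_i f i (w i)) = \prod_i avg (f i).
Proof.
rewrite /avg -bigA_distr_bigA card_ffun natrX big_split /=; congr (_ * _).
by rewrite prodr_const exprVn.
Qed.

Lemma avg_ffun1 (I T : finType) (i : I) (f : T -> R) : (0 < #|T|)%N ->
  avg (fun w : {ffun I -> T} => f (w i)) = avg f.
Proof.
move=> T0; pose g j t := if j == i then f t else 1.
rewrite (@eq_avg _ _ (fun w : {ffun I -> T} => \prod_j g j (w j))); last first.
  move=> w; rewrite (bigD1 i) //= /g eqxx big1 ?mulr1 // => j /negPf -> //.
rewrite avg_ffun_prod (bigD1 i) //= {1}/g eqxx big1 ?mulr1 // => j ji.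
by rewrite /g (negPf ji) avg_cst.
Qed.

Lemma avg_ffun2 (I T : finType) (i j : I) (f g : T -> R) : (0 < #|T|)%N -> i != j ->
  avg (fun w : {ffun I -> T} => f (w i) * g (w j)) = avg f * avg g.
Proof.
move=> T0 ij; pose h k t := if k == i then f t else if k == j then g t else 1.
rewrite (@eq_avg _ _ (fun w : {ffun I -> T} => \prod_k h k (w k))); last first.
  move=> w; rewrite (bigD1 i) //= (bigD1 j) 1?eq_sym //= /h eqxx.
  rewrite eq_sym (negPf ij) eqxx big1 ?mulr1 // => k /andP[/negPf -> /negPf ->] //.
rewrite avg_ffun_prod (bigD1 i) //= (bigD1 j) 1?eq_sym //= {1 2}/h eqxx.
rewrite eq_sym (negPf ij) eqxx big1 ?mulr1 // => k /andP[ki kj].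
by rewrite /h (negPf ki) (negPf kj) avg_cst.
Qed.

(** Pairwise independence makes the cross terms vanish. *)
Lemma avg_sqr_sum_centered (I T : finType) (f : T -> R) : (0 < #|T|)%N -> avg f = 0 ->
  avg (fun w : {ffun I -> T} => (\sum_i f (w i)) ^+ 2) = #|I|%:R * avg (fun t => f t ^+ 2).
Proof.
move=> T0 f0.
rewrite (@eq_avg _ _ (fun w : {ffun I -> T} => \sum_i \sum_j f (w i) * f (w j))); last first.
  by move=> w; rewrite expr2 big_distrlr.
rewrite avg_sum (eq_bigr (fun _ => avg (fun t => f t ^+ 2))); last first.
  move=> i _; rewrite avg_sum (bigD1 i) //= big1 ?addr0 => [|j ji].
    exact: (avg_ffun1 i (fun t => f t ^+ 2) T0).
  by rewrite avg_ffun2 1?eq_sym // f0 mul0r.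
by rewrite sumr_const mulr_natl.
Qed.

(** The variance of the mean is that of one draw divided by [#|I|], and a variance is at most the
    second moment. *)
Lemma avg_sample_mean (I T : finType) (f : T -> R) : (0 < #|T|)%N -> (0 < #|I|)%N ->
  avg (fun w : {ffun I -> T} => ((\sum_i f (w i)) / #|I|%:R - avg f) ^+ 2) <=
  avg (fun t => f t ^+ 2) / #|I|%:R.
Proof.
move=> T0 I0; have I1 : #|I|%:R != 0 :> R by rewrite pnatr_eq0 -lt0n.
pose g t := f t + - avg f * 1.
have g0 : avg g = 0 by rewrite /g avgD avgZ avg_cst // mulr1 subrr.
rewrite (@eq_avg _ _ (fun w : {ffun I -> T} => (#|I|%:R ^- 2) * (\sum_i g (w i)) ^+ 2)); last first.
  move=> w; rewrite /g big_split /= sumr_const -mulr_natl; field.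
  exact: I1.
rewrite avgZ avg_sqr_sum_centered //.
rewrite mulrA -[X in X * _](_ : #|I|%:R^-1 = _); last by field; exact: I1.
rewrite mulrC ler_wpM2r ?invr_ge0 //.
rewrite (@eq_avg _ _ (fun t => f t ^+ 2 + ((- 2 * avg f) * f t + avg f ^+ 2 * 1))); last first.
  by move=> t; rewrite /g; ring.
rewrite !avgD !avgZ avg_cst //.
by have := sqr_ge0 (avg f); nra.
Qed.

(** Markov's inequality for a penalty [f] that is at least 1 on every failure. *)
Lemma markov_avg (T : finType) (P : pred T) (f : T -> R) : (0 < #|T|)%N ->
  (forall t, 0 <= f t) -> (forall t, ~~ P t -> 1 <= f t) ->
  1 - avg f <= #|[set t | P t]|%:R / #|T|%:R.
Proof.
move=> T0 f0 f1.
have T1 : #|T|%:R != 0 :> R by rewrite pnatr_eq0 -lt0n.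
rewrite lerBlDr -[X in X <= _](mulfV T1) -mulrDl ler_wpM2r ?invr_ge0 //.
rewrite -[#|T|](@cardsC T [set t | P t]) natrD lerD2l -sum1_card natr_sum.
rewrite [leRHS](bigID (mem (~: [set t | P t]))) /= -[leLHS]addr0 lerD //.
  by apply: ler_sum => t; rewrite !inE => /f1.
by rewrite sumr_ge0.
Qed.

End Average.

(** * Unbiased floating-point rounding *)

Section RandomRounding.
Local Open Scope nat_scope.
Variables (T kap : nat).
Hypothesis kap_gt0 : 0 < kap.

(* Exponent of the unit in the last place of [v] written with [kap] significant
   bits.  It is capped by [T], the number of random bits spent on one rounding. *)
Definition scale (v : nat) : nat := (trunc_log 2 v).+1 - kap.
Definition ulp (v : nat) : nat := 2 ^ minn T (scale v).
Definition on_grid (v : nat) : bool := ulp v %| v.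

(* Rounding up exactly for [(v %% ulp v) * (2 ^ T %/ ulp v)] of the [2 ^ T] values
   of [r] makes the rounding unbiased. *)
Definition rnd (v r : nat) : nat :=
  v - v %% ulp v + (if r < v %% ulp v * (2 ^ T %/ ulp v) then ulp v else 0).

Lemma subn_modE v d : v - v %% d = v %/ d * d.
Proof. by rewrite [X in X - _](divn_eq v d) addnK. Qed.

Lemma ulp_gt0 v : 0 < ulp v. Proof. by rewrite expn_gt0. Qed.

Lemma ulp_mono v w : v <= w -> ulp v %| ulp w.
Proof.
by move=> vw; apply: dvdn_exp2l; have := leq_trunc_log 2 vw; rewrite /scale; lia.
Qed.

Lemma ulp_dvd v : ulp v %| 2 ^ T.
Proof. by apply: dvdn_exp2l; rewrite geq_minl. Qed.

Lemma scale_trunc_log v : 0 < scale v -> (scale v + kap).-1 = trunc_log 2 v.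
Proof. by rewrite /scale; lia. Qed.

Lemma scale_bounds v : 0 < v %% ulp v ->
  [/\ 2 ^ (scale v + kap).-1 <= v, v < 2 ^ (scale v + kap),
     ulp v %| 2 ^ (scale v + kap).-1 & 0 < scale v].
Proof.
move=> f0; have s0 : 0 < scale v.
  case: (posnP (scale v)) => // s0; move: f0; rewrite /ulp s0 minn0 expn0 modn1 //.
have v0 : 0 < v by case: (v) f0; rewrite ?mod0n.
have e1 := scale_trunc_log s0.
have [l1 l2] := andP (trunc_log_bounds (isT : 1 < 2) v0).
split => //; first by rewrite e1.
  by rewrite -[_ + _]prednK ?e1 //; lia.
by apply: dvdn_exp2l; lia.
Qed.

(** The next power of two is itself a multiple of the unit, so rounding up cannot jump over it. *)
Lemma round_up_le v : 0 < v %% ulp v ->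
  v < v - v %% ulp v + ulp v <= 2 ^ (scale v + kap).
Proof.
move=> f0; have [h1 h2 h3 h4] := scale_bounds f0.
have g0 := ulp_gt0 v.
have fg : v %% ulp v < ulp v by rewrite ltn_mod.
have fv : v %% ulp v <= v by apply: leq_mod.
apply/andP; split; first lia.
have /dvdnP[t ht] : ulp v %| 2 ^ (scale v + kap).
  by apply: dvdn_trans h3 _; apply: dvdn_exp2l; lia.
move: h2; rewrite ht subn_modE -mulSnr => h2.
by rewrite leq_mul2r; apply/orP; right; rewrite ltn_divLR.
Qed.

Lemma on_grid0 : on_grid 0. Proof. exact: dvdn0. Qed.

Lemma rnd_cases v r : rnd v r = v - v %% ulp v \/
  0 < v %% ulp v /\ rnd v r = v - v %% ulp v + ulp v.
Proof.
rewrite /rnd; case: (posnP (v %% ulp v)) => [->|f0]; first by left; rewrite mul0n addn0.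
by case: ifP => _; [right|left; rewrite addn0].
Qed.

Lemma rnd_on_grid v r : on_grid (rnd v r).
Proof.
have dq : ulp v %| v - v %% ulp v.
  by rewrite subn_modE dvdn_mull.
have [->|[f0 ->]] := rnd_cases v r; rewrite /on_grid.
  by apply: dvdn_trans (ulp_mono (leq_subr _ _)) dq.
have [h1 h2 h3 h4] := scale_bounds f0; have /andP[u1 u2] := round_up_le f0.
set w := _ + _ in u1 u2 *.
have dw : ulp v %| w by rewrite dvdn_addl.
have [ew|nw] := eqVneq w (2 ^ (scale v + kap)).
  (* At the next power of two the unit may double; it still divides that power because [kap] is
     positive. *)
  rewrite ew /ulp; apply: dvdn_exp2l; rewrite {1}/scale trunc_expnK //.
  by move: (scale v) h4 kap_gt0 => s; clear; lia.
suff -> : ulp w = ulp v by [].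
rewrite /ulp /scale; congr (2 ^ minn _ (_.+1 - _)).
rewrite -(scale_trunc_log h4); apply: trunc_log_eq => //; rewrite (leq_trans h1 (ltnW u1)) /=.
by rewrite prednK ?addn_gt0 ?h4 // ltn_neqAle nw.
Qed.

(** If the unit is unchanged, it divides [a]. Otherwise a power of two divisible by the new unit
    lies above [a] and not above [a + s], and the excess over it is at most [s]. *)
Lemma modn_ulp_le a s : on_grid a -> (a + s) %% ulp (a + s) <= s.
Proof.
move=> ga; have [e|ne] := eqVneq (ulp a) (ulp (a + s)).
  by rewrite -e -modnDml (eqP ga) add0n leq_mod.
case: (posnP ((a + s) %% ulp (a + s))) => [->//|f0].
have [h1 h2 h3 h4] := scale_bounds f0.
have a1 : a < 2 ^ (scale (a + s) + kap).-1.
  have lt_sc : scale a < scale (a + s).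
    rewrite ltnNge; apply: contra ne => le; have := leq_trunc_log 2 (leq_addr s a).
    move: le; rewrite /ulp /scale => le1 le2; apply/eqP; congr (2 ^ _); lia.
  case: (posnP a) => [->|a0]; first by rewrite expn_gt0.
  have [l1 l2] := andP (trunc_log_bounds (isT : 1 < 2) a0).
  by apply: leq_trans l2 _; rewrite leq_exp2l //; move: lt_sc; rewrite /scale; clear; lia.
move: (2 ^ _) (ulp _) h1 h3 a1 => t g h1 h3 a1.
rewrite -(subnK h1) -modnDmr (eqP h3) addn0.
by apply: leq_trans (leq_mod _ _) _; clear -a1 h1; lia.
Qed.

Lemma rnd_ge a s r : on_grid a -> a <= rnd (a + s) r.
Proof. by move=> /(modn_ulp_le s) h; rewrite /rnd; lia. Qed.

(** Remainder times unit bounds the variance of one rounding. The remainder is at most [s] and,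
    unless it is 0, the unit is at most [2 * (a + s) / 2 ^ kap]. *)
Lemma ulp_error a s : on_grid a ->
  (a + s) %% ulp (a + s) * ulp (a + s) * 2 ^ kap <= 2 * (a + s) * s.
Proof.
move=> ga; have h := modn_ulp_le s ga; move: (a + s) h => v h.
case: (posnP (v %% ulp v)) => [->//|f0].
have [h1 h2 h3 h4] := scale_bounds f0.
have hg : ulp v * 2 ^ kap <= 2 * v.
  apply: (@leq_trans (2 ^ scale v * 2 ^ kap)).
    by rewrite leq_mul2r leq_exp2l // geq_minr orbT.
  rewrite -expnD -[_ + _]prednK; last lia.
  by rewrite expnS leq_mul2l h1 orbT.
by rewrite -mulnA mulnC leq_mul.
Qed.

Lemma rnd_representable v r : rnd v r <= 2 ^ T ->
  exists (a : 'I_(2 ^ kap).+1) (b : 'I_T.+1), rnd v r = a * 2 ^ b.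
Proof.
(* Past the cap, [v] is at least [2 ^ T.+1] and loses less than [2 ^ T], so the result would exceed
   [2 ^ T]. *)
have [sT|Ts] := leqP (scale v) T; last first.
  move=> le; have u : ulp v = 2 ^ T by rewrite /ulp; congr (2 ^ _); lia.
  have v0 : 0 < v by case: (v) Ts => //; rewrite /scale trunc_log0; lia.
  have [l1 l2] := andP (trunc_log_bounds (isT : 1 < 2) v0).
  have l3 : 2 ^ T.+1 <= v.
    by apply: leq_trans l1; rewrite leq_exp2l //; move: Ts; rewrite /scale; lia.
  have := ltn_pmod v (ulp_gt0 v); move: le l3; rewrite /rnd u expnS.
  by case: ifP => _; lia.
move=> _; have u : ulp v = 2 ^ scale v by rewrite /ulp; congr (2 ^ _); lia.
have vlt : v < 2 ^ (scale v + kap).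
  case: (posnP v) => [->|v0]; first by rewrite expn_gt0.
  have [l1 l2] := andP (trunc_log_bounds (isT : 1 < 2) v0).
  by apply: leq_trans l2 _; rewrite leq_exp2l // /scale; lia.
have b1 : scale v < T.+1 by [].
have a1 : v %/ ulp v < 2 ^ kap.
  by rewrite ltn_divLR ?ulp_gt0 // u -expnD addnC.
have [->|[f0 ->]] := rnd_cases v r; rewrite subn_modE -?mulSnr.
  exists (Ordinal (leqW a1)), (Ordinal b1); by rewrite -u.
(* Rounding up may produce the mantissa [2 ^ kap] itself, hence the extra value in the ordinal. *)
have a2 : (v %/ ulp v).+1 < (2 ^ kap).+1 by [].
by exists (Ordinal a2), (Ordinal b1); rewrite -u.
Qed.

Fixpoint chain (a : nat) (ss rs : seq nat) : nat :=
  match ss, rs with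
  | s :: ss', r :: rs' => chain (rnd (a + s) r) ss' rs'
  | _, _ => a
  end.

Lemma chain_ge a ss rs : on_grid a -> a <= chain a ss rs.
Proof.
elim: ss a rs => [|s ss IH] a [|r rs] //= ga.
by apply: leq_trans (IH _ _ (rnd_on_grid _ _)); exact: rnd_ge.
Qed.

Local Open Scope ring_scope.
Variable R : realType.

Lemma avg_threshold (n c : nat) (x y : R) : (0 < n)%N -> (c <= n)%N ->
  avg (fun r : 'I_n => if (r < c)%N then x else y) =
  (c%:R * x + (n - c)%:R * y) / n%:R.
Proof.
move=> n0 cn; rewrite /avg card_ord; congr (_ / _).
rewrite -(big_mkord xpredT (fun r => if (r < c)%N then x else y)).
rewrite (big_cat_nat (leq0n c) cn) /=; congr (_ + _).
  rewrite big_nat (eq_bigr (fun=> x)) => [|i /andP[_ ->]] //.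
  by rewrite -big_nat sumr_const_nat subn0 mulr_natl.
rewrite big_nat (eq_bigr (fun=> y)) => [|i /andP[ci _]]; last by rewrite ltnNge ci.
by rewrite -big_nat sumr_const_nat mulr_natl.
Qed.

Lemma rnd_threshold v : (v %% ulp v * (2 ^ T %/ ulp v) <= 2 ^ T)%N.
Proof.
rewrite -[leqRHS](divnK (ulp_dvd v)) mulnC leq_mul2l.
by rewrite ltnW ?orbT // ltn_mod ulp_gt0.
Qed.

Lemma avg_rnd (v : nat) (phi : nat -> R) :
  avg (fun r : 'I_(2 ^ T) => phi (rnd v r)) =
  ((v %% ulp v)%:R * phi (v - v %% ulp v + ulp v)%N +
   ((ulp v)%:R - (v %% ulp v)%:R) * phi (v - v %% ulp v)%N) / (ulp v)%:R.
Proof.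
have g0 : (ulp v)%:R != 0 :> R by rewrite pnatr_eq0 -lt0n ulp_gt0.
have h0 : (2 ^ T %/ ulp v)%:R != 0 :> R.
  by rewrite pnatr_eq0 -lt0n divn_gt0 ?ulp_gt0 // dvdn_leq ?expn_gt0 ?ulp_dvd.
rewrite -(@eq_avg _ _ (fun r : 'I_(2 ^ T) => if (r < v %% ulp v * (2 ^ T %/ ulp v))%N then
  phi (v - v %% ulp v + ulp v)%N else phi (v - v %% ulp v)%N)); last first.
  by move=> r; rewrite /rnd; case: ifP; rewrite ?addn0.
rewrite avg_threshold ?expn_gt0 ?rnd_threshold // natrB ?rnd_threshold //.
have -> : (2 ^ T)%:R = (2 ^ T %/ ulp v)%:R * (ulp v)%:R :> R.
  by rewrite -natrM divnK ?ulp_dvd.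
by rewrite natrM; field; rewrite g0 h0.
Qed.

Lemma avg_rnd1 v : avg (fun r : 'I_(2 ^ T) => (rnd v r)%:R : R) = v%:R.
Proof.
rewrite (avg_rnd v (fun n => n%:R)) natrD natrB ?leq_mod //.
by field; rewrite pnatr_eq0 -lt0n ulp_gt0.
Qed.

Lemma avg_rnd2 a s : on_grid a ->
  avg (fun r : 'I_(2 ^ T) => (rnd (a + s) r)%:R ^+ 2 : R) <=
  (a + s)%:R ^+ 2 + 2 / 2 ^+ kap * (a + s)%:R * s%:R.
Proof.
move=> ga; have le := ulp_error s ga; move: (a + s)%N le => v le.
rewrite (avg_rnd v (fun n => n%:R ^+ 2)) natrD natrB ?leq_mod //.
have g0 : (ulp v)%:R != 0 :> R by rewrite pnatr_eq0 -lt0n ulp_gt0.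
set f : R := (v %% ulp v)%:R; set g : R := (ulp v)%:R in g0 *.
(* The variance of this two-valued variable is [f * (g - f)]. *)
have -> : (f * (v%:R - f + g) ^+ 2 + (g - f) * (v%:R - f) ^+ 2) / g =
  v%:R ^+ 2 + (f * g - f ^+ 2) by field.
rewrite lerD2l; apply: le_trans (_ : f * g <= _); first by rewrite gerBl sqr_ge0.
rewrite -2!mulrA [_^-1 * _]mulrC !mulrA ler_pdivlMr ?exprn_gt0 //.
by rewrite -natrX -!natrM ler_nat.
Qed.

Lemma avg_chain1 ss a :
  avg (fun rs : (size ss).-tuple 'I_(2 ^ T) =>
    (chain a ss (map val rs))%:R : R) = (a + sumn ss)%:R.
Proof.
have N0 : (0 < #|'I_(2 ^ T)|)%N by rewrite card_ord expn_gt0.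
elim: ss a => [|s ss IH] a /=.
  by rewrite avg_cst ?card_tuple ?expn_gt0 ?N0 // addn0.
rewrite avg_cons /= (@eq_avg _ _ _ (fun x : 'I_(2 ^ T) => (rnd (a + s) x)%:R + (sumn ss)%:R * 1)).
  by rewrite avgD avgZ avg_rnd1 avg_cst // mulr1 -natrD addnA.
by move=> x; rewrite (IH (rnd (a + s) x)) natrD mulr1.
Qed.

(** Conditioning on the first rounding involves only its mean and second moment. The product of the
    final total and the sum of the shares is a form of bound that survives this induction. *)
Lemma avg_chain2 ss a : on_grid a ->
  avg (fun rs : (size ss).-tuple 'I_(2 ^ T) =>
    (chain a ss (map val rs))%:R ^+ 2 : R) <=
  (a + sumn ss)%:R ^+ 2 + 2 / 2 ^+ kap * (a + sumn ss)%:R * (sumn ss)%:R.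
Proof.
have N0 : (0 < #|'I_(2 ^ T)|)%N by rewrite card_ord expn_gt0.
elim: ss a => [|s ss IH] a ga /=.
  by rewrite avg_cst ?card_tuple ?expn_gt0 ?N0 // addn0 mulr0 addr0.
rewrite avg_cons /=.
set S : R := (sumn ss)%:R; set c : R := 2 / 2 ^+ kap.
have c0 : 0 <= c by rewrite divr_ge0 // exprn_ge0.
apply: le_trans (_ : avg (fun x : 'I_(2 ^ T) => (rnd (a + s) x)%:R ^+ 2 +
    ((2 * S + c * S) * (rnd (a + s) x)%:R + (S ^+ 2 + c * S ^+ 2) * 1)) <= _).
  apply: le_avg => x; apply: le_trans (IH _ (rnd_on_grid _ _)) _.
  by rewrite natrD -/S -/c le_eqVlt; apply/orP; left; apply/eqP; ring.
rewrite !avgD !avgZ avg_rnd1 avg_cst //.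
apply: le_trans (lerD (avg_rnd2 s ga) (lexx _)) _.
rewrite !natrD -/c -/S; have S0 : 0 <= S by [].
have a0 : 0 <= a%:R :> R by []. have s0 : 0 <= s%:R :> R by [].
(* This is exactly the slack between the bound obtained and the one claimed. *)
have csS : 0 <= c * S * s%:R by apply: mulr_ge0 => //; apply: mulr_ge0.
rewrite -subr_ge0; apply: le_trans csS _; rewrite le_eqVlt; apply/orP; left; apply/eqP.
by ring.
Qed.

(** The chain is unbiased, so its mean square error is the excess of its second moment; the number
    of roundings does not enter. *)
Lemma avg_chain_error ss :
  avg (fun rs : (size ss).-tuple 'I_(2 ^ T) =>
    ((chain 0 ss (map val rs))%:R - (sumn ss)%:R) ^+ 2 : R) <=
  2 / 2 ^+ kap * (sumn ss)%:R ^+ 2.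
Proof.
have N0 : (0 < #|'I_(2 ^ T)|)%N by rewrite card_ord expn_gt0.
set S : R := (sumn ss)%:R.
rewrite (@eq_avg _ _ _ (fun rs : (size ss).-tuple 'I_(2 ^ T) =>
    (chain 0 ss (map val rs))%:R ^+ 2 + ((- (2 * S)) * (chain 0 ss (map val rs))%:R
    + S ^+ 2 * 1))); last by move=> rs; ring.
rewrite !avgD !avgZ avg_chain1 avg_cst ?card_tuple ?expn_gt0 ?N0 // add0n.
have := avg_chain2 ss on_grid0; rewrite add0n -/S; nra.
Qed.

End RandomRounding.

(** * The Laplace transform of a heavy-tailed variable *)

Section Transform.
Variables (R : realType) (A : nat).
Hypothesis A_gt0 : (0 < A)%N.
Implicit Types s : R.

(* For [j] uniform, [P (jump j >= k)] is [1 / k] up to [1 / A]: the discrete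
   analogue of the inverse of a uniform variable. *)
Definition jump (j : 'I_A) : nat := (A %/ j.+1)%N.

Definition laplace s : R := avg (fun j : 'I_A => expR (- (s * (jump j)%:R))).

(** The first [A] terms of the series of [- ln (1 - expR (- s))]. *)
Definition log_series s : R := \sum_(k < A) expR (- (k.+1%:R * s)) / k.+1%:R.

Lemma jump_le j : (jump j <= A)%N. Proof. exact: leq_div. Qed.

Lemma jump_gt0 j : (0 < jump j)%N.
Proof. by rewrite divn_gt0 // ltn_ord. Qed.

(** Summation by parts: with [z = expR (- s)], [1 - z ^+ jump j] is [1 - z] times a geometric sum,
    whose term [z ^+ k] is present with probability [(A %/ k.+1) / A]. *)
Lemma laplace_compl s : 1 - laplace s =
  (1 - expR (- s)) * \sum_(k < A) expR (- s) ^+ k * ((A %/ k.+1)%:R / A%:R).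
Proof.
set z := expR (- s); have A0 : (0 < #|'I_A|)%N by rewrite card_ord.
rewrite -[X in X - _](avg_cst 1 A0) -[- laplace s]mulN1r -avgZ -avgD.
rewrite (@eq_avg _ _ _ (fun j : 'I_A => (1 - z) *
    \sum_(k < A) if (k < jump j)%N then z ^+ k else 0)); last first.
  move=> j; rewrite mulN1r mulrC -mulrN expRM_natl -/z.
  rewrite -[LHS]opprB subrX1 -mulNr opprB; congr (_ * _).
  by rewrite (big_ord_widen A (fun k => z ^+ k)) ?jump_le // big_mkcond.
rewrite avgZ avg_sum; congr (_ * _); apply: eq_bigr => k _.
rewrite (@eq_avg _ _ _ (fun j : 'I_A => if (j < A %/ k.+1)%N then z ^+ k else 0)).
  by rewrite avg_threshold // ?leq_div // mulr0 addr0 [_%:R * _]mulrC mulrA.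
(* Both [k < A %/ j.+1] and [j < A %/ k.+1] say [k.+1 * j.+1 <= A]. *)
by move=> j; rewrite /jump leq_divRL // mulnC -leq_divRL.
Qed.

Lemma floor_frac_bounds k :
  (k.+1%:R^-1 - A%:R^-1 <= (A %/ k.+1)%:R / A%:R :> R) &&
  ((A %/ k.+1)%:R / A%:R <= k.+1%:R^-1 :> R).
Proof.
have A0 : 0 < A%:R :> R by rewrite ltr0n.
have k0 : 0 < k.+1%:R :> R by [].
apply/andP; split; last first.
  rewrite ler_pdivrMr // mulrC ler_pdivlMr // -natrM ler_nat; exact: leq_trunc_div.
rewrite ler_pdivlMr // mulrBl mulVf ?gt_eqF // mulrC lerBlDr natr1.
rewrite ler_pdivrMr // -natrM ler_nat.
by rewrite ltnW // ltn_ceil.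
Qed.

(** Replacing each floor by its real quotient costs at most [1 / A] per term, and [1 - expR (- s)]
    times the geometric sum is at most 1. *)
Lemma laplace_bounds s : 0 < s ->
  (expR s - 1) * log_series s - A%:R^-1 <= 1 - laplace s <= (expR s - 1) * log_series s.
Proof.
move=> s0; have A0 : 0 < A%:R :> R by rewrite ltr0n.
have z1 : expR (- s) < 1 by rewrite expR_lt1 oppr_lt0.
have z0 := expR_gt0 (- s).
have -> : (expR s - 1) * log_series s =
    (1 - expR (- s)) * \sum_(k < A) expR (- s) ^+ k / k.+1%:R.
  have -> : expR s - 1 = (1 - expR (- s)) * expR s.
    by rewrite mulrBl mul1r -expRD addNr expR0.
  rewrite -mulrA; congr (_ * _); rewrite mulr_sumr; apply: eq_bigr => k _.
  by rewrite mulrA -expRD -expRM_natl; congr (expR _ / _); rewrite -natr1; ring.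
rewrite laplace_compl; apply/andP; split; last first.
  apply: ler_wpM2l; first by rewrite subr_ge0 ltW.
  apply: ler_sum => k _; apply: ler_wpM2l; first by rewrite exprn_ge0 // ltW.
  by have /andP[] := floor_frac_bounds k.
set z := expR (- s) in z1 z0 *.
rewrite [X in _ - X <= _](_ : _ = (1 - z) * (A%:R^-1 / (1 - z))); last first.
  by field; rewrite subr_eq0 !gt_eqF.
rewrite -mulrBr; apply: ler_wpM2l; first by rewrite subr_ge0 ltW.
have geo : \sum_(k < A) z ^+ k <= (1 - z)^-1.
  rewrite -[leRHS]mul1r ler_pdivlMr ?subr_gt0 // mulrC -[1 - z]opprB mulNr -subrX1.
  by rewrite opprB gerBl exprn_ge0 // ltW.
rewrite lerBlDr; apply: le_trans (lerD (lexx _) (ler_wpM2l _ geo)); last first.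
  by rewrite invr_ge0 ltW.
rewrite mulr_sumr -big_split; apply: ler_sum => k _ /=.
rewrite [A%:R^-1 * _]mulrC -mulrDr; apply: ler_wpM2l; first by rewrite exprn_ge0 // ltW.
by rewrite -lerBlDr; have /andP[] := floor_frac_bounds k.
Qed.

(** For positive [s], minus the remainder after [A] terms of the series of
    [- ln (1 - expR (- s))]. *)
Definition log_gap s : R := log_series s + ln (1 - expR (- s)).

(** The logarithm contributes a full geometric series and [log_series] takes away its first [A]
    terms; the tail remains. *)
Lemma is_derive_log_gap s : 0 < s ->
  is_derive s 1 log_gap (expR (- (A%:R * s)) / (expR s - 1)).
Proof.
move=> s0; have z1 : expR (- s) < 1 by rewrite expR_lt1 oppr_lt0.
have z0 := expR_gt0 (- s).
have dexp (a : R) : is_derive s 1 (fun x => expR (- (a * x))) (- a * expR (- (a * s))).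
  rewrite [X in is_derive _ _ _ X]mulrC.
  apply: (@is_derive1_comp R expR (fun x => - (a * x))).
  rewrite (_ : (fun x => _) = (- a) \*: id); last by apply/funext => x; rewrite [RHS]mulNr.
  by apply: is_derive_eq; rewrite [LHS]mulr1.
have dh (k : 'I_A) : is_derive s 1 (fun x => expR (- (k.+1%:R * x)) / k.+1%:R)
    (- expR (- s) ^+ k.+1).
  rewrite (_ : (fun x => _) = k.+1%:R^-1 \*: (fun x => expR (- (k.+1%:R * x)))).
    apply: is_derive_eq; rewrite [LHS]mulrA mulrN mulVf ?pnatr_eq0 // mulN1r.
    by rewrite -expRM_natl mulrN.
  by apply/funext => x; rewrite [RHS]mulrC.
have dln : is_derive s 1 (fun x => ln (1 - expR (- x))) (expR (- s) / (1 - expR (- s))).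
  rewrite [X in is_derive _ _ _ X]mulrC.
  apply: (@is_derive1_comp R (@ln R) (fun x => 1 - expR (- x))); first by apply: is_derive1_ln; rewrite subr_gt0.
  have d1 := dexp 1; rewrite (_ : (fun x => _) =
    cst 1 - (fun x => expR (- (1 * x)))); last by apply/funext => x; rewrite -[RHS]/(1 - expR (- (1 * x))) mul1r.
  by apply: is_derive_eq; rewrite !mul1r sub0r mulN1r opprK.
rewrite (_ : log_gap = (\sum_(k < A) (fun x => expR (- (k.+1%:R * x)) / k.+1%:R)) +
   (fun x => ln (1 - expR (- x)))); last first.
  by apply/funext => x; rewrite /log_gap /log_series /= fct_sumE.
apply: is_derive_eq.
have zs : expR s = (expR (- s))^-1 by rewrite expRN invrK.
rewrite -mulrN expRM_natl zs.
set z := expR (- s) in z1 z0 *.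
under eq_bigr do rewrite exprS.
rewrite sumrN -mulr_sumr.
have : (1 - z) * \sum_(i < A) z ^+ i = 1 - z ^+ A.
  by rewrite -[1 - z]opprB mulNr -subrX1 opprB.
set S := \sum_(i < A) _ => hS.
have -> : S = (1 - z ^+ A) / (1 - z) by rewrite -hS; field; rewrite subr_eq0 gt_eqF.
by field; rewrite gt_eqF //= mulN1r subr_eq0 gt_eqF.
Qed.

(* [log_gap] is almost constant, so [log_series s] is [- ln s] up to a constant
   which is never computed: [log_gap 1] serves as its value. *)
Lemma log_gap_bounds s0 s : 0 < s0 -> s0 <= s -> s <= 1 ->
  log_gap 1 - (s0 ^+ 2 * A%:R)^-1 <= log_gap s <= log_gap 1.
Proof.
move=> s00 s0s s1; have sp : 0 < s := lt_le_trans s00 s0s.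
have A0 : 0 < A%:R :> R by rewrite ltr0n.
have [x||x xs1 e] := @MVT_segment R log_gap
    (fun x => expR (- (A%:R * x)) / (expR x - 1)) s 1 s1.
- by rewrite in_itv /= => /andP[sx _]; apply: is_derive_log_gap; exact: lt_trans sx.
- apply/derivable_within_continuous => x; rewrite in_itv /= => /andP[sx _].
  by apply: ex_derive; apply: is_derive_log_gap; exact: lt_le_trans sx.
have {xs1} [sx x1] : s <= x /\ x <= 1 by move: xs1; rewrite in_itv /= => /andP.
have xp : 0 < x := lt_le_trans sp sx.
have Ex : x <= expR x - 1 by rewrite lerBrDr addrC expR_ge1Dx.
have Ep : 0 < expR x - 1 := lt_le_trans xp Ex.
have d0 : 0 <= expR (- (A%:R * x)) / (expR x - 1) by rewrite divr_ge0 ?expR_ge0 // ltW.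
(* From [expR (- t) <= 1 / t] at [t = A * x], and [x <= expR x - 1]. *)
have d1 : expR (- (A%:R * x)) / (expR x - 1) <= (s0 ^+ 2 * A%:R)^-1.
  have AX : 0 < A%:R * x by rewrite mulr_gt0.
  apply: (@le_trans _ _ ((A%:R * x)^-1 * x^-1)).
    apply: ler_pM; rewrite ?expR_ge0 ?invr_ge0 ?(ltW Ep) //; last first.
      by rewrite lef_pV2 ?posrE.
    rewrite expRN lef_pV2 ?posrE ?expR_gt0 //.
    by apply: le_trans (expR_ge1Dx _); rewrite lerDr.
  rewrite -invfM lef_pV2 ?posrE ?mulr_gt0 // ?exprn_gt0 //.
  have -> : A%:R * x * x = x ^+ 2 * A%:R by ring.
  rewrite ler_wpM2r ?ler0n //.
  by rewrite lerXn2r ?nnegrE ?(ltW s00) ?(ltW xp) // (le_trans s0s).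
have p0 : 0 <= expR (- (A%:R * x)) / (expR x - 1) * (1 - s).
  by rewrite mulr_ge0 // subr_ge0.
have p1 : expR (- (A%:R * x)) / (expR x - 1) * (1 - s) <= (s0 ^+ 2 * A%:R)^-1.
  by apply: le_trans d1; rewrite ler_piMr // gerBl ltW.
by apply/andP; split; lra.
Qed.

Lemma log_gap1_le1 : log_gap 1 <= 1.
Proof.
have h2 : expR (- 1) <= 2^-1 :> R.
  rewrite expRN lef_pV2 ?posrE ?expR_gt0 //.
  by apply: le_trans (expR_ge1Dx _); rewrite -[2]/(1 + 1).
rewrite -[leRHS]addr0 lerD //; last by rewrite ln_le0 // gerBl expR_ge0.
apply: (@le_trans _ _ (\sum_(k < A) (2^-1 : R) ^+ k / 2)).
  apply: ler_sum => k _; rewrite -mulrN expRM_natl exprSr.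
  apply: (@le_trans _ _ (expR (- 1) ^+ k * expR (- 1))).
    by rewrite ler_piMr ?mulr_ge0 ?exprn_ge0 ?expR_ge0 // invf_le1 ?ler1n.
  apply: ler_pM => //; [exact/exprn_ge0/expR_ge0|exact: expR_ge0|].
  by rewrite lerXn2r ?nnegrE ?expR_ge0 // invr_ge0.
rewrite -mulr_suml; have := subrX1 (2^-1 : R) A; set S := \sum_(i < A) _.
have : 0 <= (2^-1 : R) ^+ A by rewrite exprn_ge0 // invr_ge0.
by lra.
Qed.

Lemma ln_le_subr1 (x : R) : 0 < x -> ln x <= x - 1.
Proof.
move=> x0; rewrite -[X in ln X](subrK 1) [_ + 1]addrC; apply: le_ln1Dx.
by rewrite ltrBrDr addNr.
Qed.

Lemma ln1B_ge (d : R) : d <= 2^-1 -> - d - 2 * d ^+ 2 <= ln (1 - d).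
Proof.
move=> d2; have d1 : 0 < 1 - d by lra.
rewrite -[ln _]opprK -lnV ?posrE // lerNr opprB opprK.
apply: le_trans (ln_le_subr1 _) _; first by rewrite invr_gt0.
rewrite lerBlDr -[leLHS]mul1r ler_pdivrMr //.
have : 0 <= d ^+ 2 * (1 - 2 * d) by rewrite mulr_ge0 ?sqr_ge0 //; lra.
by nra.
Qed.

(** Used with [r] the fourth root of [s]: it makes [(s * ln s) ^+ 2] at most of order
    [s * Num.sqrt s]. *)
Lemma oppr_ln_le_root (r : R) : 0 < r -> - ln (r ^+ 4) <= 4 * (r^-1 - 1).
Proof.
move=> r0; have := @ln_le_subr1 r^-1; rewrite invr_gt0 lnV ?posrE // => /(_ r0).
by rewrite lnXn // -[ln r *+ 4]mulr_natl; lra.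
Qed.

(** [1 - laplace s] is close to [s * log_series s], hence to [s * (log_gap 1 - ln s)], and
    [ln (1 - d)] is close to [- d]. The lower bound [s0] controls the truncation at [A]. *)
Lemma ln_laplace s0 s : 0 < s0 -> s0 <= s -> s <= 256^-1 ->
  `| ln (laplace s) - s * (ln s - log_gap 1) | <=
  s * (65 * Num.sqrt s + 2 / (s0 ^+ 2 * A%:R)).
Proof.
move=> s00 s0s s1; have sp : 0 < s := lt_le_trans s00 s0s.
have A0 : 0 < A%:R :> R by rewrite ltr0n.
have sle1 : s <= 1 by lra.
have /andP[g1 g2] := log_gap_bounds s00 s0s sle1.
have c1 := log_gap1_le1.
have tA : A%:R^-1 <= s * (s0 ^+ 2 * A%:R)^-1.
  rewrite invfM mulrA ler_peMl ?invr_ge0 // ler_pdivlMr ?exprn_gt0 // mul1r.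
  by apply: le_trans (s0s); rewrite expr2 ler_piMr ?(ltW s00) // (le_trans s0s).
set t := _^-1 in g1 tA *; set c := log_gap 1 in g1 g2 c1 *.
have t0 : 0 <= t by rewrite invr_ge0 mulr_ge0 ?exprn_ge0 // ltW.
(* Errors are compared as powers of the fourth root [r] of [s]; [s <= 256^-1] means [r <= 4^-1]. *)
pose r := Num.sqrt (Num.sqrt s).
have r0 : 0 < r by rewrite !sqrtr_gt0.
have r2 : Num.sqrt s = r ^+ 2 by rewrite sqr_sqrtr // sqrtr_ge0.
have r4 : s = r ^+ 4 by rewrite -[4%N]/(2 * 2)%N exprM -r2 sqr_sqrtr // ltW.
have r1 : r <= 4^-1.
  rewrite leNgt; apply/negP => lt; have : 4^-1 ^+ 4 < r ^+ 4.
    by rewrite ltrXn2r // ?nnegrE ?invr_ge0 ?(ltW r0).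
  by rewrite -r4; lra.
have z1 : expR (- s) < 1 by rewrite expR_lt1 oppr_lt0.
have l1 : - ln s <= 4 * (r^-1 - 1) by rewrite r4; exact: oppr_ln_le_root.
have k1 : ln (1 - expR (- s)) <= ln s.
  by rewrite ler_ln ?posrE ?subr_gt0 //; have := expR_ge1Dx (- s); lra.
have k2 : ln s - s <= ln (1 - expR (- s)).
  rewrite -[X in _ - X]expRK -ln_div ?posrE ?expR_gt0 // -expRN.
  rewrite ler_ln ?posrE ?mulr_gt0 ?expR_gt0 ?subr_gt0 //.
  rewrite lerBrDr -[X in _ + X]mul1r -mulrDl.
  have := expR_ge1Dx s; rewrite addrC => le.
  by apply: le_trans (ler_wpM2r (expR_ge0 _) le) _; rewrite -expRD subrr expR0.
have /andP[d1 d2] := laplace_bounds sp.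
have hE : log_gap s = log_series s + ln (1 - expR (- s)) by [].
have h0 : 0 <= log_series s.
  by apply: sumr_ge0 => k _; rewrite divr_ge0 ?expR_ge0.
set h := log_series s in d1 d2 hE h0 *.
have E1 : s <= expR s - 1 by rewrite lerBrDr addrC expR_ge1Dx.
have E2 : expR s - 1 <= s * (1 + 2 * s).
  have e1 := expR_ge1Dx (- s).
  have e2 : expR s <= (1 - s)^-1.
    by rewrite -[expR s]invrK lef_pV2 ?posrE ?invr_gt0 ?expR_gt0 -?expRN //; lra.
  have e3 : (1 - s)^-1 <= 1 + s * (1 + 2 * s).
    rewrite -[leLHS]mul1r ler_pdivrMr; last by lra.
    have : 0 <= s ^+ 2 * (1 - 2 * s) by rewrite mulr_ge0 ?sqr_ge0 //; lra.
    by nra.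
  by lra.
set E := expR s - 1 in d1 d2 E1 E2 *.
(* [h] is at most of order [1 / r], so [q] is bounded and [s * h] is at most of order [r ^+ 3]. *)
pose q := r * h.
have rr : r * r^-1 = 1 by rewrite mulfV // gt_eqF.
have q0 : 0 <= q by rewrite mulr_ge0 // ltW.
have q4 : q <= 4.
  have h1 : h <= 4 * (r^-1 - 1) + s + 1 by lra.
  have := ler_wpM2l (ltW r0) h1; have : r * s <= r by rewrite ler_piMr // ltW.
  have -> : r * (4 * (r^-1 - 1) + s + 1) = 4 * (r * r^-1) - 4 * r + r * s + r by ring.
  by rewrite rr -/q; lra.
have sh : s * h = r ^+ 3 * q by rewrite r4 /q; ring.
have r30 : 0 <= r ^+ 3 by rewrite exprn_ge0 // ltW.
have sh4 : s * h <= 4 * r ^+ 3 by rewrite sh mulrC ler_wpM2r.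
have sh0 : 0 <= s * h by rewrite mulr_ge0 // ltW.
have Eh1 : s * h <= E * h by rewrite ler_wpM2r.
have Eh2 : E * h <= s * h + 2 * s * (s * h).
  by apply: le_trans (ler_wpM2r h0 E2) _; rewrite le_eqVlt; apply/orP; left; apply/eqP; ring.
have ssh : s * (s * h) <= s * (4 * r ^+ 3) by rewrite ler_wpM2l // ltW.
have Eh3 : E * h <= 5 * r ^+ 3.
  have : s * (4 * r ^+ 3) <= 256^-1 * (4 * r ^+ 3).
    by rewrite ler_wpM2r // mulr_ge0.
  by lra.
set d := 1 - laplace s in d1 d2.
have dE : laplace s = 1 - d by rewrite /d; ring.
have d0 : 0 <= d.
  rewrite /d subr_ge0 -[leRHS](@avg_cst R 'I_A) ?card_ord //.
  by apply: le_avg => j; rewrite -[leRHS]expR0 ler_expR oppr_le0 mulr_ge0 ?ler0n // ltW.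
have d5 : d <= 5 * r ^+ 3 := le_trans d2 Eh3.
have r3 : r ^+ 3 <= 64^-1.
  have := lerXn2r 3 (_ : r \in Num.nneg) (_ : 4^-1 \in Num.nneg) r1.
  rewrite !nnegrE (ltW r0) invr_ge0 => /(_ isT (ler0n _ _)).
  by rewrite exprVn -natrX.
have dd : d ^+ 2 <= 25 * (s * r ^+ 2).
  have -> : 25 * (s * r ^+ 2) = (5 * r ^+ 3) ^+ 2 by rewrite r4; ring.
  by rewrite lerXn2r ?nnegrE // (le_trans d0).
have u1 : ln (1 - d) <= - d.
  by apply: le_ln1Dx; lra.
have u2 : - d - 2 * d ^+ 2 <= ln (1 - d) by apply: ln1B_ge; lra.
rewrite dE r2 ler_norml.
have sl : s * h = s * (log_gap s - ln (1 - expR (- s))) by rewrite hE; ring.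
have m1 : s * (- ln s + c - t) <= s * h by rewrite ler_wpM2l ?(ltW sp) //; lra.
have m2 : s * h <= s * (- ln s + s + c) by rewrite ler_wpM2l ?(ltW sp) //; lra.
have r2s : s <= 16^-1 * r ^+ 2.
  have : r ^+ 2 <= 16^-1.
    have -> : 16^-1 = 4^-1 ^+ 2 :> R by rewrite exprVn -natrX.
    by rewrite lerXn2r ?nnegrE ?invr_ge0 // ltW.
  move=> le; have -> : s = r ^+ 2 * r ^+ 2 by rewrite r4; ring.
  by rewrite ler_wpM2r // exprn_ge0 // ltW.
have r3s : r ^+ 3 <= 4^-1 * r ^+ 2.
  by rewrite exprS ler_wpM2r // exprn_ge0 // ltW.
have w1 : s * s <= s * (16^-1 * r ^+ 2) by rewrite ler_wpM2l // ltW.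
have w2 : s * r ^+ 3 <= s * (4^-1 * r ^+ 2) by rewrite ler_wpM2l // ltW.
have w3 : 0 <= s * t by rewrite mulr_ge0 // ltW.
have w4 : 0 <= s * r ^+ 2 by rewrite mulr_ge0 ?exprn_ge0 // ltW.
have -> : s * (65 * r ^+ 2 + 2 * t) = 65 * (s * r ^+ 2) + 2 * (s * t) by ring.
have e1 : s * (- ln s + c - t) = - (s * (ln s - c)) - s * t by ring.
have e2 : s * (- ln s + s + c) = - (s * (ln s - c)) + s * s by ring.
move: (s * (ln s - c)) e1 e2 => X e1 e2; rewrite e1 in m1; rewrite e2 in m2.
have Eh4 : E * h <= s * h + 8 * (s * r ^+ 3) by lra.
by apply/andP; split; lra.
Qed.

End Transform.

(** * Moments of the exponential of a sketch *)

Section Sketch.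
Variables (R : realType) (A L n : nat).
Hypotheses (A_gt0 : (0 < A)%N) (L_ge : (512 <= L)%N).
Variable x : 'I_n -> nat.
Let F := (\sum_i x i)%N.
Hypothesis F_gt0 : (0 < F)%N.

Definition weight (w : {ffun 'I_L * 'I_n -> 'I_A}) (i : 'I_n) : nat :=
  (\sum_l jump (w (l, i)))%N.

Definition sketch (w : {ffun 'I_L * 'I_n -> 'I_A}) : nat :=
  (\sum_i x i * weight w i)%N.

Lemma avg_expR_sketch (b : R) :
  avg (fun w => expR (- (b * (sketch w)%:R))) =
  \prod_i laplace A (b * (x i)%:R) ^+ L.
Proof.
rewrite (@eq_avg _ _ _ (fun w : {ffun 'I_L * 'I_n -> 'I_A} =>
    \prod_q expR (- (b * (x q.2)%:R * (jump (w q))%:R)))); last first.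
  move=> w; rewrite -expR_sum; congr expR; rewrite sumrN; congr (- _).
  rewrite [RHS](_ : _ = \sum_l \sum_i b * (x i)%:R * (jump (w (l, i)))%:R); last first.
    by rewrite pair_bigA; apply: eq_bigr => -[].
  rewrite exchange_big /sketch natr_sum mulr_sumr; apply: eq_bigr => i _.
  by rewrite natrM natr_sum mulrA mulr_sumr.
rewrite (avg_ffun_prod (fun q (j : 'I_A) => expR (- (b * (x q.2)%:R * (jump j)%:R)))).
rewrite [LHS](_ : _ = \prod_(l < L) \prod_i laplace A (b * (x i)%:R)); last first.
  by rewrite pair_bigA.
rewrite exchange_big; apply: eq_bigr => i _.
by rewrite prodr_const card_ord.
Qed.

Let p (i : 'I_n) : R := (x i)%:R / F%:R.
Let H : R := \sum_i p i * ln (1 / p i).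
Let c : R := log_gap A 1.
(** The relative error of [ln_laplace] on arguments between [1 / (L * F)] and [2 / L]. *)
Let eta : R := 65 * Num.sqrt (2 / L%:R) + 2 * (L%:R * F%:R) ^+ 2 / A%:R.
Let mean (b : R) := avg (fun w => expR (- (b / (L%:R * F%:R) * (sketch w)%:R))).

Let F_neq0 : F%:R != 0 :> R.
Proof. by rewrite pnatr_eq0 -lt0n. Qed.

Let L_gt0 : 0 < L%:R :> R.
Proof. by rewrite ltr0n; exact: leq_trans L_ge. Qed.

Let p_sum : \sum_i p i = 1.
Proof. by rewrite -mulr_suml -natr_sum mulfV // F_neq0. Qed.

Let p_ge0 i : 0 <= p i.
Proof. by rewrite divr_ge0. Qed.

Let p_le1 i : p i <= 1.
Proof.
by rewrite ler_pdivrMr ?ltr0n // mul1r ler_nat /F (bigD1 i) //= leq_addr.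
Qed.

(** The transform is taken at [b * p i / L], and the [L] copies restore the factor [b * p i]. The
    values [b = 1] and [b = 2] give the first two moments of [expR (- y)]. *)
Lemma ln_laplace_coord (b : R) i : 1 <= b <= 2 ->
  `| L%:R * ln (laplace A (b / (L%:R * F%:R) * (x i)%:R)) -
     b * p i * (ln b - ln (1 / p i) - ln L%:R - c) | <= b * p i * eta.
Proof.
move=> /andP[b1 b2]; have L0 := L_gt0; have F0 : 0 < F%:R :> R by rewrite ltr0n.
have [xi0|xi0] := posnP (x i).
  rewrite /p xi0 !(mul0r, mulr0) subr0.
  have -> : laplace A (0 : R) = 1.
    rewrite -(@avg_cst R 'I_A 1) ?card_ord //; apply: eq_avg => j.
    by rewrite mul0r oppr0 expR0.
  by rewrite ln1 mulr0 normr0.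
have xi1 : 1 <= (x i)%:R :> R by rewrite ler1n.
have p0 : 0 < p i by rewrite divr_gt0 // ltr0n.
have -> : b / (L%:R * F%:R) * (x i)%:R = b * p i / L%:R.
  by rewrite /p; field; rewrite !gt_eqF.
set s := b * p i / L%:R.
have b0 : 0 < b by lra.
have LF0 : 0 < (L%:R * F%:R)^-1 :> R by rewrite invr_gt0 mulr_gt0.
have s0 : (L%:R * F%:R)^-1 <= s.
  have -> : s = (L%:R * F%:R)^-1 * (b * (x i)%:R).
    by rewrite /s /p; field; rewrite !gt_eqF.
  rewrite ler_peMr ?(ltW LF0) // -[leLHS]mul1r ler_pM //.
have s2 : s <= 2 / L%:R.
  rewrite /s ler_pM2r ?invr_gt0 // -[leRHS]mulr1.
  by apply: ler_pM; rewrite ?(ltW b0) ?p_ge0 ?p_le1.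
have L256 : 2 / L%:R <= 256^-1 :> R.
  rewrite ler_pdivrMr // ler_pdivlMl // -natrM ler_nat; exact: L_ge.
have sp : 0 < s by exact: lt_le_trans s0.
have le := ln_laplace A_gt0 LF0 s0 (le_trans s2 L256).
have lns : ln s = ln b - ln (1 / p i) - ln L%:R.
  rewrite div1r [ln (p i)^-1]lnV ?posrE // opprK /s.
  have bp0 : 0 < b * p i := mulr_gt0 b0 p0.
  by rewrite (@ln_div _ (b * p i)) ?(@lnM _ b) ?posrE.
rewrite -lns.
have -> : L%:R * ln (laplace A s) - b * p i * (ln s - c) =
    L%:R * (ln (laplace A s) - s * (ln s - c)).
  by rewrite /s; field; rewrite gt_eqF.
rewrite normrM gtr0_norm //.
have bp : L%:R * s = b * p i by rewrite /s; field; rewrite gt_eqF.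
rewrite -bp -mulrA ler_pM2l //; apply: le_trans le _; rewrite ler_pM2l //.
apply: lerD.
  by rewrite ler_pM2l // ler_wsqrtr.
by rewrite exprVn invfM invrK mulrA.
Qed.

(** The weights [p i] add up to 1, so the coordinate errors add up to at most [b * eta], while the
    terms [p i * ln (1 / p i)] add up to [H]. *)
Lemma mean_expE b : 1 <= b <= 2 ->
  exists2 r : R, mean b = expR (b * (ln b - H - ln L%:R - c) + r) & `|r| <= b * eta.
Proof.
move=> b12.
pose y i := L%:R * ln (laplace A (b / (L%:R * F%:R) * (x i)%:R)).
exists (\sum_i (y i - b * p i * (ln b - ln (1 / p i) - ln L%:R - c))).
  rewrite /mean avg_expR_sketch.
  rewrite (eq_bigr (fun i => expR (y i))); last first.
    move=> i _; rewrite /y expRM_natl lnK // posrE.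
    rewrite /laplace divr_gt0 ?ltr0n ?card_ord // (bigD1 (Ordinal A_gt0)) //=.
    by rewrite ltr_pwDl ?expR_gt0 // sumr_ge0 // => j _; exact: expR_ge0.
  rewrite -expR_sum sumrB [X in _ = expR X](_ : _ = \sum_i y i) //.
  rewrite [X in _ + (_ - X)](_ : _ = b * (ln b - H - ln L%:R - c)); first by ring.
  rewrite (eq_bigr (fun i => b * (ln b - ln L%:R - c) * p i - b * (p i * ln (1 / p i)))).
    by rewrite sumrB -!mulr_sumr p_sum -/H; ring.
  by move=> i _; ring.
apply: le_trans (ler_norm_sum _ _ _) _.
apply: le_trans (ler_sum _ (fun i _ => ln_laplace_coord i b12)) _.
by rewrite -mulr_suml -mulr_sumr p_sum mulr1.
Qed.

(** In the exponent of the ratio only [2 * ln 2] and errors of at most [4 * eta <= 1 / 2 <= ln 2]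
    remain. *)
Lemma mean_second_moment : eta <= 8^-1 -> mean 2 <= 8 * mean 1 ^+ 2.
Proof.
move=> e8; have [|r1 m1 h1] := @mean_expE 1; first by rewrite lexx ler1n.
have [|r2 m2 h2] := @mean_expE 2; first by rewrite ler1n lexx.
rewrite m1 m2 -expRM_natl.
have -> : 8 = 2 ^+ 2 * 2 :> R by ring.
have two : 2 = expR (ln 2) :> R by rewrite lnK // posrE.
have ln2h : 2^-1 <= ln 2 :> R.
  have := @ln_le_subr1 R 2^-1; rewrite invr_gt0 lnV ?posrE // => /(_ (ltr0n _ 2)); lra.
rewrite [X in X ^+ 2 * X]two -expRM_natl -!expRD ler_expR ln1.
move: h1 h2; rewrite !ler_norml => /andP[h1 h1'] /andP[h2 h2'].
by lra.
Qed.

(** A nonzero integer coordinate has [p i >= 1 / F]. *)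
Lemma entropy_le (N : R) : F%:R <= N -> H <= ln N.
Proof.
move=> FN; have F0 : 0 < F%:R :> R by rewrite ltr0n.
have N0 : 0 < N := lt_le_trans F0 FN.
have -> : ln N = \sum_i p i * ln N by rewrite -mulr_suml p_sum mul1r.
apply: ler_sum => i _; have [xi0|xi0] := posnP (x i); first by rewrite /p xi0 !mul0r.
apply: ler_wpM2l; first exact: p_ge0.
have p0 : 0 < p i by rewrite divr_gt0 // ltr0n.
rewrite div1r ler_ln ?posrE ?invr_gt0 // /p invf_div.
by apply: le_trans FN; rewrite ler_pdivrMr ?ltr0n // ler_peMr ?ler1n ?ler0n.
Qed.

(** Makes the tail beyond [Y] negligible relative to the mean. The factor 8 absorbs [c <= 1] and
    [eta], as [ln 8 >= 3 / 2]. *)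
Lemma mean_ge (N : R) : F%:R <= N -> eta <= 8^-1 -> (8 * N * L%:R)^-1 <= mean 1.
Proof.
move=> FN e8; have L0 := L_gt0; have F0 : 0 < F%:R :> R by rewrite ltr0n.
have N0 : 0 < N := lt_le_trans F0 FN.
have [|r m h] := @mean_expE 1; first by rewrite lexx ler1n.
have e2 : expR (ln (8 * N * L%:R)) = 8 * N * L%:R by rewrite lnK // posrE !mulr_gt0.
rewrite m -e2 -expRN ler_expR !lnM ?posrE ?mulr_gt0 // ln1.
have c1 : c <= 1 := log_gap1_le1 R A.
have HN := entropy_le FN.
have ln8 : 3 / 2 <= ln 8 :> R.
  have -> : 8 = 2 ^+ 3 :> R by ring.
  have := @ln_le_subr1 R 2^-1; rewrite invr_gt0 lnV ?posrE // => /(_ (ltr0n _ 2)).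
  by rewrite lnXn // -[ln 2 *+ 3]mulr_natl; lra.
move: h; rewrite ler_norml => /andP[h h'].
by lra.
Qed.

End Sketch.

(** * Robustness of the estimator *)

Section Perturbation.
Variable R : realType.
Implicit Types a d t y Y : R.

Lemma expR_sub1_le t : `|t| <= 2^-1 -> `|expR t - 1| <= 2 * `|t|.
Proof.
rewrite !ler_norml => /andP[t1 t2].
have h1 := expR_ge1Dx t; have h2 := expR_ge1Dx (- t).
have nt : t <= `|t| /\ - t <= `|t| by rewrite !ler_norm -normrN ler_norm.
have [nt1 nt2] := nt; have n2 : `|t| <= 2^-1 by rewrite ler_norml t1.
have p0 : 0 < 1 - t by lra.
have h3 : expR t <= (1 - t)^-1.
  by rewrite -[expR t]invrK lef_pV2 ?posrE ?invr_gt0 ?expR_gt0 // -expRN; lra.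
have h4 : (1 - t)^-1 <= 1 + 2 * `|t|.
  rewrite -[leLHS]mul1r ler_pdivrMr //.
  have : 0 <= `|t| * (1 - 2 * t) by rewrite mulr_ge0 //; lra.
  by lra.
by apply/andP; split; lra.
Qed.

(* Far in the tail, where a relative error on [y] is useless, both exponentials
   are negligible. *)
Lemma expRN_perturb a y y' Y : 0 <= y -> 0 <= a -> 0 <= Y -> a * Y <= 2^-1 -> a <= 2^-1 ->
  `|y' - y| <= a * y ->
  `|expR (- y') - expR (- y)| <= 2 * (a * Y) * expR (- y) + expR (- (Y / 2)).
Proof.
move=> y0 a0 Y0 aY a2 yy; have [yY|Yy] := leP y Y.
  have ayY : a * y <= a * Y by rewrite ler_wpM2l.
  have tle : `|y - y'| <= a * Y by rewrite distrC (le_trans yy).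
  have -> : expR (- y') - expR (- y) = expR (- y) * (expR (y - y') - 1).
    by rewrite mulrBr mulr1 -expRD; congr (expR _ - _); ring.
  rewrite normrM ger0_norm ?expR_ge0 // mulrC -[leLHS]addr0 lerD ?expR_ge0 //.
  rewrite ler_wpM2r ?expR_ge0 // (le_trans (expR_sub1_le (le_trans tle aY))) //.
  by rewrite ler_pM2l.
have y'Y : Y / 2 <= y'.
  have ay2 : a * y <= 2^-1 * y by rewrite ler_wpM2r.
  by move: yy; rewrite ler_norml => /andP[yy _]; lra.
have e1 : expR (- y') <= expR (- (Y / 2)) by rewrite ler_expR lerN2.
have e2 : expR (- y) <= expR (- (Y / 2)) by rewrite ler_expR lerN2; lra.
have e3 := expR_ge0 (- y); have e4 := expR_ge0 (- y').
have e5 : 0 <= 2 * (a * Y) * expR (- y) by rewrite !mulr_ge0.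
by rewrite ler_norml; apply/andP; split; lra.
Qed.

Lemma ratio_perturb d (S S' F F' : R) : 0 <= d -> d <= 4^-1 -> 0 <= S -> 0 < F ->
  `|S' - S| <= d * S -> `|F' - F| <= d * F ->
  `|S' / F' - S / F| <= 4 * d * (S / F).
Proof.
move=> d0 d4 S0 F0; rewrite !ler_norml => /andP[s1 s2] /andP[f1 f2].
have dF : d * F <= 4^-1 * F by rewrite ler_wpM2r // ltW.
have F'0 : 0 < F' by lra.
have -> : S' / F' - S / F = (S' * F - S * F') / (F * F').
  by field; rewrite !gt_eqF.
have -> : 4 * d * (S / F) = 4 * d * (S * F') / (F * F').
  by field; rewrite !gt_eqF.
have FF : 0 < F * F' by rewrite mulr_gt0.
rewrite -mulNr !ler_pM2r ?invr_gt0 //.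
have k1 : S * F' <= S * (F + d * F) by rewrite ler_wpM2l //; lra.
have k2 : S * (F - d * F) <= S * F' by rewrite ler_wpM2l //; lra.
have k3 : S' * F <= (S + d * S) * F by rewrite ler_wpM2r ?(ltW F0) //; lra.
have k4 : (S - d * S) * F <= S' * F by rewrite ler_wpM2r ?(ltW F0) //; lra.
have k5 : d * (S * (F - d * F)) <= d * (S * F') by rewrite ler_wpM2l.
have SF : 0 <= d * (S * F) by rewrite !mulr_ge0 // ltW.
have dSF : d * (d * (S * F)) <= 4^-1 * (d * (S * F)) by rewrite ler_wpM2r.
by apply/andP; split; lra.
Qed.

Lemma ln_ratio_le (mu m e : R) : 0 < mu -> e <= 2^-1 -> `|m - mu| <= e * mu ->
  `|ln m - ln mu| <= 2 * e.
Proof.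
move=> mu0 e2; rewrite !ler_norml => /andP[m1 m2].
have em : e * mu <= 2^-1 * mu by rewrite ler_wpM2r // ltW.
have m0 : 0 < m by lra.
have h1 := @ln_le_subr1 R (m / mu); have h2 := @ln_le_subr1 R (mu / m).
rewrite !ln_div ?posrE ?divr_gt0 // in h1 h2.
have {}h1 := h1 isT; have {}h2 := h2 isT.
have e0 : 0 <= e by rewrite -(pmulr_lge0 _ mu0); lra.
have k1 : m / mu - 1 <= e by rewrite lerBlDr ler_pdivrMr //; lra.
have k2 : mu / m - 1 <= 2 * e.
  rewrite lerBlDr ler_pdivrMr //.
  have : 2^-1 * mu <= m by lra.
  by move=> /(ler_wpM2l e0); lra.
by apply/andP; split; lra.
Qed.

(** Budget relative to [mu]: [eps / 8] for relative errors below [Y], [eps / 16] for the tail and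
    [eps / 16] for sampling. The logarithm doubles their sum [eps / 4]. *)
Lemma estimate_accuracy (I : finType) (y y' : I -> R) (mu d Y eps : R) :
  (0 < #|I|)%N -> 0 < mu -> 0 <= d -> 0 <= Y -> 0 < eps -> eps < 1 -> d <= 8^-1 ->
  128 * d * Y <= eps -> 16 * expR (- (Y / 2)) <= eps * mu ->
  (forall i, 0 <= y i) -> (forall i, `|y' i - y i| <= 4 * d * y i) ->
  `|(\sum_i expR (- y i)) / #|I|%:R - mu| <= eps / 16 * mu ->
  `|ln ((\sum_i expR (- y' i)) / #|I|%:R) - ln mu| <= eps / 2.
Proof.
move=> I0 mu0 d0 Y0 eps0 eps1 d8 dY eY y0 yy hm.
have Ip : 0 < #|I|%:R :> R by rewrite ltr0n.
set m := _ / _ in hm; set m' := _ / _.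
have mm : `|m' - m| <= 8 * d * Y * m + expR (- (Y / 2)).
  rewrite /m /m' -mulrBl normrM [X in _ * X]ger0_norm ?invr_ge0 ?(ltW Ip) //.
  rewrite ler_pdivrMr // mulrDl [8 * d * Y * _]mulrA mulfVK ?gt_eqF //.
  rewrite -sumrB (le_trans (ler_norm_sum _ _ _)) //.
  have -> : 8 * d * Y * \sum_i expR (- y i) + expR (- (Y / 2)) * #|I|%:R =
     \sum_i (2 * (4 * d * Y) * expR (- y i) + expR (- (Y / 2))).
    by rewrite big_split /= sumr_const -mulr_sumr mulr_natr; ring.
  apply: ler_sum => i _; apply: expRN_perturb => //; last by lra.
    by rewrite mulr_ge0.
  by lra.
have m0 : 0 <= m by rewrite divr_ge0 ?sumr_ge0 // => i _; exact: expR_ge0.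
have dYm : 8 * d * Y * m <= eps / 16 * m by rewrite ler_wpM2r //; lra.
have em : eps * mu <= mu by rewrite ler_piMl // ltW.
have emu : 0 < eps * mu by rewrite mulr_gt0.
move: hm; rewrite ler_norml => /andP[q1 q2].
have epm : eps * m <= eps * (2 * mu) by rewrite ler_pM2l //; lra.
have -> : eps / 2 = 2 * (eps / 4) by field.
apply: ln_ratio_le => //; first by lra.
move: mm; rewrite !ler_norml => /andP[q3 q4].
by apply/andP; split; lra.
Qed.

End Perturbation.

(** * The protocol *)

(** A bijection preserves uniform averages, so the coins can be read as seeds and roundings. *)
Lemma card_eq_bij (T U : finType) : #|T| = #|U| -> exists f : T -> U, bijective f.
Proof.
move=> e; exists (fun t => enum_val (cast_ord e (enum_rank t))).
exists (fun u => enum_val (cast_ord (esym e) (enum_rank u))) => t.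
  by rewrite enum_valK cast_ordK enum_rankK.
by rewrite enum_valK cast_ordKV enum_rankK.
Qed.

Lemma card_le_cancel (T U : finType) (t0 : T) : (#|T| <= #|U|)%N ->
  exists (f : T -> U) (g : U -> T), cancel f g.
Proof.
move=> le; pose f t : U := enum_val (widen_ord le (enum_rank t)).
have fI : injective f.
  move=> t t' /enum_val_inj/(congr1 val)/= e; apply: enum_rank_inj; exact: val_inj.
exists f, (fun u => odflt t0 [pick t | f t == u]) => t.
by case: pickP => [t' /eqP/fI //|/(_ t)]; rewrite eqxx.
Qed.

(** * Shares added along the tour *)

Section TourShares.
Local Open Scope nat_scope.
Variables (V : finType) (q : seq V) (f : V -> nat).

(** A vertex may be visited several times; it contributes only at its first visit, the stop
    [index w q]. *)
Fixpoint tour_shares (rest : seq V) (j : nat) : seq nat :=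
  if rest is w :: rest' then (if index w q == j then f w else 0) :: tour_shares rest' j.+1
  else [::].

Lemma size_tour_shares rest j : size (tour_shares rest j) = size rest.
Proof. by elim: rest j => //= w rest IH j; rewrite IH. Qed.

Lemma sumn_tour_shares : (forall u, u \in q) -> sumn (tour_shares q 0) = \sum_u f u.
Proof.
move=> allq.
(* [pre] is the part already walked: only vertices outside it have still to contribute. *)
suff H pre rest : q = pre ++ rest ->
    sumn (tour_shares rest (size pre)) = \sum_(u | (u \in rest) && (u \notin pre)) f u.
  by rewrite (H [::] q) //; apply: eq_bigl => u; rewrite allq.
elim: rest pre => [|w rest IH] pre e /=; first by rewrite big_pred0.
rewrite -[in tour_shares _ _](size_rcons pre w) IH ?cat_rcons //.
rewrite e index_cat; case: (boolP (w \in pre)) => wp.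
  rewrite ltn_eqF ?index_mem // add0n; apply: eq_bigl => u.
  rewrite in_cons mem_rcons in_cons negb_or.
  by case: eqP => //= ->; rewrite wp andbF.
rewrite /= eqxx addn0 eqxx [RHS](bigD1 w) ?mem_head //=; congr (_ + _).
apply: eq_bigl => u; rewrite in_cons mem_rcons in_cons negb_or.
by case: eqP => //=; rewrite ?andbF ?andbT.
Qed.

End TourShares.

(** * Storing counters as floats *)

Section Floats.
Local Open Scope nat_scope.
Variables (T kap : nat).

Definition float := ('I_(2 ^ kap).+1 * 'I_T.+1)%type.
Definition float_val (a : float) : nat := a.1 * 2 ^ a.2.
(** A chosen preimage under [float_val]; a number that is not representable is sent to the zero
    float. *)
Definition float_of (v : nat) : float :=
  odflt (ord0, ord0) [pick a | float_val a == v].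

Lemma float_rnd v r : 0 < kap -> rnd T kap v r <= 2 ^ T ->
  float_val (float_of (rnd T kap v r)) = rnd T kap v r.
Proof.
move=> k0 /(rnd_representable k0)[a [b e]]; rewrite /float_of; case: pickP => [c /eqP //|].
by move=> /(_ (a, b)); rewrite /float_val e eqxx.
Qed.

Lemma float0 : float_val (float_of 0) = 0.
Proof.
rewrite /float_of; case: pickP => [c /eqP //|/(_ (ord0, ord0))].
by rewrite /float_val mul0n eqxx.
Qed.

End Floats.

Lemma avg_chain_error_size (R : realType) T kap n ss : (0 < kap)%N -> size ss = n ->
  avg (fun rs : n.-tuple 'I_(2 ^ T) =>
    ((chain T kap 0 ss (map val rs))%:R - (sumn ss)%:R) ^+ 2 : R) <=
  2 / 2 ^+ kap * (sumn ss)%:R ^+ 2.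
Proof. by move=> k0 <-; exact: avg_chain_error. Qed.

(** * The sketching protocol and its analysis *)

Section EntropyProtocol.
Variables (R : realType) (V : finType) (e : rel V) (o : V) (p : seq V) (n M : nat).
Variables (k L al T kap B N : nat) (d Y eps : R).
Hypothesis graph_e : connected_graph e.
Hypotheses (tour_path : path e o p) (tour_closed : last o p = o).
Hypotheses (tour_uniq : uniq (hops o p)) (tour_all : forall v, v \in o :: p).

Local Notation A := (2 ^ al)%N.
Local Notation input := {ffun 'I_n -> 'I_M.+1}.
Local Notation J := (size p).+1.
Local Notation seed := {ffun 'I_L * 'I_n -> 'I_(2 ^ al)}.
Local Notation seeds := {ffun 'I_k -> seed}.
Local Notation roundings := {ffun option 'I_k -> J.-tuple 'I_(2 ^ T)}.
Local Notation state := {ffun option 'I_k -> float T kap}.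

(* Counter [None] estimates the l1 norm, counter [Some l] the [l]-th sketch. *)
Definition counter_weight (w : seeds) (c : option 'I_k) (i : 'I_n) : nat :=
  if c is Some l then weight (w l) i else 1%N.

Definition share (w : seeds) (c : option 'I_k) (x : input) : nat :=
  (\sum_i x i * counter_weight w c i)%N.

Definition update (w : seeds * roundings) (x : input) (u : V) (j : nat) (st : state) : state :=
  [ffun c => float_of T kap (rnd T kap
     (float_val (st c) + (if index u (o :: p) == j then share w.1 c x else 0))
     (nth 0%N (map val (w.2 c)) j))].

(** Solves [ln E (exp (- y)) = - H - ln L - c] for [H], the expectation being replaced by the mean
    over the stored sketches. *)
Definition estimate (st : state) : R :=
  - ln ((\sum_(l < k) expR (- ((float_val (st (Some l)))%:R / L%:R /
      (float_val (st None))%:R))) / k%:R) - ln L%:R - log_gap A 1.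

Fixpoint tour_state (w : seeds * roundings) (X : V -> input) (rest : seq V) (j : nat)
    (st : state) : state :=
  if rest is v :: rest' then tour_state w X rest' j.+1 (update w (X v) v j st) else st.

Hypothesis kap_gt0 : (0 < kap)%N.

(** The chain never decreases, so if its last value is at most [2 ^ T] then so are all earlier ones,
    and storing them as floats loses nothing. *)
Lemma tour_state_chain (w : seeds * roundings) X rest j (st : state) c
    (a := float_val (st c)) :
  on_grid T kap a -> (j + size rest)%N = J ->
  (chain T kap a (tour_shares (o :: p) (fun u => share w.1 c (X u)) rest j)
     (drop j (map val (w.2 c))) <= 2 ^ T)%N ->
  float_val (tour_state w X rest j st c) =
  chain T kap a (tour_shares (o :: p) (fun u => share w.1 c (X u)) rest j)
     (drop j (map val (w.2 c))).
Proof.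
rewrite /a {a}; elim: rest j st => [|v rest IH] j st ga sz //=.
have jJ : (j < J)%N by rewrite -sz /=; lia.
rewrite (drop_nth 0%N) ?size_map ?size_tuple //= => le.
have fv : float_val (update w (X v) v j st c) =
    rnd T kap (float_val (st c) + (if index v (o :: p) == j then share w.1 c (X v) else 0))
     (nth 0%N (map val (w.2 c)) j).
  rewrite ffunE float_rnd //; apply: leq_trans le.
  by apply: chain_ge => //; exact: rnd_on_grid.
rewrite IH ?fv //; first exact: rnd_on_grid.
by rewrite -sz /= addnS.
Qed.

(** The value with which a counter would end if the float format never overflowed. *)
Definition final_counter (w : seeds * roundings) (X : V -> input) (c : option 'I_k) : nat :=
  chain T kap 0 (tour_shares (o :: p) (fun u => share w.1 c (X u)) (o :: p) 0)
     (map val (w.2 c)).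

Lemma tour_state_counter (w : seeds * roundings) X c : (final_counter w X c <= 2 ^ T)%N ->
  float_val (tour_state w X (o :: p) 0 [ffun => float_of T kap 0] c) = final_counter w X c.
Proof.
move=> le; rewrite tour_state_chain ?ffunE ?float0 ?drop0 //.
exact: on_grid0.
Qed.

Definition total (X : V -> input) (i : 'I_n) : nat := (\sum_u X u i)%N.

Lemma sum_share (w : seeds) (X : V -> input) c :
  (\sum_u share w c (X u) = \sum_i total X i * counter_weight w c i)%N.
Proof.
by rewrite /share exchange_big; apply: eq_bigr => i _; rewrite /total big_distrl.
Qed.

Lemma avg_final_counter_error (w : seeds) (X : V -> input) c :
  avg (fun rs : roundings =>
    ((final_counter (w, rs) X c)%:R - (\sum_u share w c (X u))%:R) ^+ 2 : R) <=
  2 / 2 ^+ kap * (\sum_u share w c (X u))%:R ^+ 2.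
Proof.
have T0 : (0 < #|{: J.-tuple 'I_(2 ^ T)}|)%N by rewrite card_tuple card_ord !expn_gt0.
rewrite -(sumn_tour_shares _ tour_all).
apply: le_trans (avg_chain_error_size R T kap_gt0 (size_tour_shares _ _ _ _)).
rewrite (avg_ffun1 c (fun rs : J.-tuple 'I_(2 ^ T) => ((chain T kap 0 (tour_shares (o :: p)
  (fun u => share w c (X u)) (o :: p) 0) (map val rs))%:R -
  (sumn (tour_shares (o :: p) (fun u => share w c (X u)) (o :: p) 0))%:R) ^+ 2)) //.
Qed.

Hypotheses (k_gt0 : (0 < k)%N) (L_ge : (512 <= L)%N).
Hypothesis N_ge : (#|V| * n * M <= N)%N.
Hypotheses (eps_gt0 : 0 < eps) (eps_lt1 : eps < 1).
Hypotheses (d_gt0 : 0 < d) (d_le : d <= 8^-1) (Y_ge0 : 0 <= Y).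
Hypothesis eta_le : 65 * Num.sqrt (2 / L%:R) + 2 * (L%:R * N%:R) ^+ 2 / A%:R <= eps / 8.
Hypothesis dY_le : 128 * d * Y <= eps.
Hypothesis expY_le : 16 * expR (- (Y / 2)) <= eps * (8 * N%:R * L%:R)^-1.
Hypothesis T_ge : (2 * (N * (L * A)) <= 2 ^ T)%N.
Hypothesis k_ge : 8 / (k%:R * (eps / 16) ^+ 2) <= 6^-1.
Hypothesis kap_ge : k.+1%:R * (2 / (2 ^+ kap * d ^+ 2)) <= 6^-1.

(** * Accuracy on a fixed nonzero input *)

Section FixedInput.
Variable X : V -> input.
Let x := total X.
Let F := (\sum_i x i)%N.
Hypothesis F_gt0 : (0 < F)%N.

Let mu : R := avg (fun w : seed => expR (- (1 / (L%:R * F%:R) * (sketch x w)%:R))).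
Let H : R := \sum_i (x i)%:R / F%:R * ln (1 / ((x i)%:R / F%:R)).
Let sample_mean (w : seeds) : R :=
  (\sum_l expR (- (1 / (L%:R * F%:R) * (sketch x (w l))%:R))) / k%:R.
Let true_counter (w : seeds) c : nat := (\sum_u share w c (X u))%N.

(* At least 1 as soon as some counter or the sample mean is off. *)
Definition penalty (w : seeds * roundings) : R :=
  (sample_mean w.1 - mu) ^+ 2 / (eps / 16 * mu) ^+ 2 +
  \sum_c ((final_counter w X c)%:R - (true_counter w.1 c)%:R) ^+ 2 /
           (d * (true_counter w.1 c)%:R) ^+ 2.

Let A_gt0 : (0 < A)%N. Proof. by rewrite expn_gt0. Qed.

Let total_le : (F <= N)%N.
Proof.
apply: leq_trans N_ge; rewrite /F /x /total exchange_big /= mulnAC.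
rewrite -mulnA -sum_nat_const; apply: leq_sum => u _.
rewrite -[X in (_ <= _ * X)%N]card_ord mulnC -sum_nat_const; apply: leq_sum => i _.
by rewrite -ltnS.
Qed.

Let eta_F : 65 * Num.sqrt (2 / L%:R) + 2 * (L%:R * F%:R) ^+ 2 / A%:R <= eps / 8 :> R.
Proof.
apply: le_trans eta_le; rewrite lerD2l ler_wpM2r ?invr_ge0 ?ler0n // ler_wpM2l //.
by rewrite lerXn2r ?nnegrE ?mulr_ge0 // ler_wpM2l // ler_nat total_le.
Qed.

Let eta_F8 : 65 * Num.sqrt (2 / L%:R) + 2 * (L%:R * F%:R) ^+ 2 / A%:R <= 8^-1 :> R.
Proof. by apply: le_trans eta_F _; have := eps_lt1; lra. Qed.

Let N_gt0 : (0 < N)%N. Proof. exact: leq_trans total_le. Qed.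

Let mu_ge : (8 * N%:R * L%:R)^-1 <= mu.
Proof. by apply: (mean_ge A_gt0 L_ge F_gt0 _ eta_F8); rewrite ler_nat total_le. Qed.

Let LR_gt0 : 0 < L%:R :> R.
Proof. by rewrite ltr0n; apply: leq_trans L_ge. Qed.

Let mu_gt0 : 0 < mu.
Proof.
apply: lt_le_trans mu_ge; rewrite invr_gt0 !mulr_gt0 ?LR_gt0 // ltr0n; exact: N_gt0.
Qed.

Lemma true_counterE w c :
  true_counter w c = if c is Some l then sketch x (w l) else F.
Proof.
rewrite /true_counter sum_share; case: c => [l|] //=.
by apply: eq_bigr => i _; rewrite muln1.
Qed.

(** Jumps are positive, so a sketch is at least [F]. The relative errors in [penalty] divide by
    these counters. *)
Lemma true_counter_gt0 w c : (0 < true_counter w c)%N.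
Proof.
rewrite true_counterE; case: c => // l; apply: leq_trans F_gt0 _.
apply: leq_sum => i _; rewrite leq_pmulr // /weight.
have L0 : (0 < L)%N by apply: leq_trans L_ge.
by rewrite (bigD1 (Ordinal L0)) //= ltn_addr // jump_gt0.
Qed.

Lemma true_counter_le w c : (true_counter w c <= N * (L * A))%N.
Proof.
rewrite true_counterE; apply: leq_trans (_ : F * (L * A) <= _)%N; last first.
  by rewrite leq_mul2r total_le orbT.
case: c => [l|]; last first.
  by rewrite leq_pmulr // muln_gt0 A_gt0 andbT; apply: leq_trans L_ge.
rewrite big_distrl; apply: leq_sum => i _; rewrite leq_mul2l; apply/orP; right.
rewrite /weight -[X in (_ <= X * _)%N]card_ord -sum_nat_const; apply: leq_sum => j _.
exact: jump_le.
Qed.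

(** Squaring [expR (- y)] doubles its exponent, so the second moment is the one bounded in
    [mean_second_moment]. *)
Lemma avg_sample_error :
  avg (fun w : seeds => (sample_mean w - mu) ^+ 2) <= 8 * mu ^+ 2 / k%:R.
Proof.
have seed0 : (0 < #|{: seed}|)%N by rewrite card_ffun card_ord !expn_gt0.
have k0 : (0 < #|'I_k|)%N by rewrite card_ord.
have := avg_sample_mean (fun w : seed => expR (- (1 / (L%:R * F%:R) * (sketch x w)%:R)) : R) seed0 k0.
rewrite card_ord => /le_trans; apply; rewrite ler_wpM2r ?invr_ge0 //.
apply: le_trans (mean_second_moment A_gt0 L_ge F_gt0 eta_F8).
rewrite le_eqVlt; apply/orP; left; apply/eqP; apply: eq_avg => w.
by rewrite -expRM_natl; congr expR; ring.
Qed.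

(** The choice of [k] leaves 1/6 for the sample mean, and the choice of [kap] leaves 1/6 for the
    [k.+1] counters together. *)
Lemma avg_penalty : avg penalty <= 3^-1.
Proof.
have seeds0 : (0 < #|{: seeds}|)%N by rewrite !card_ffun card_ord !expn_gt0.
have rnd0 : (0 < #|{: roundings}|)%N by rewrite card_ffun card_tuple card_ord !expn_gt0.
have m0 := mu_gt0.
have -> : 3^-1 = 6^-1 + 6^-1 :> R by field.
rewrite /penalty avgD; apply: lerD.
  rewrite (avg_fst (fun w => (sample_mean w - mu) ^+ 2 / (eps / 16 * mu) ^+ 2)) //.
  apply: le_trans k_ge.
  rewrite (@eq_avg _ _ _ (fun w => (eps / 16 * mu) ^- 2 * (sample_mean w - mu) ^+ 2)).
    rewrite avgZ; apply: le_trans (ler_wpM2l _ avg_sample_error) _.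
      by rewrite invr_ge0 sqr_ge0.
    rewrite le_eqVlt; apply/orP; left; apply/eqP; field.
    by rewrite !gt_eqF // ltr0n.
  by move=> w; rewrite mulrC.
(* The seeds are fixed first, so the true counters are constants while the roundings are
   averaged. *)
apply: le_trans kap_ge; rewrite avg_pair.
rewrite -[leRHS](avg_cst _ seeds0); apply: le_avg => w /=.
rewrite avg_sum; apply: le_trans (_ : \sum_(c : option 'I_k) 2 / (2 ^+ kap * d ^+ 2) <= _).
  apply: ler_sum => c _; set t := true_counter w c.
  have t0 : 0 < t%:R :> R by rewrite ltr0n true_counter_gt0.
  rewrite (@eq_avg _ _ _ (fun rs => (d * t%:R) ^- 2 * ((final_counter (w, rs) X c)%:R - t%:R) ^+ 2)).
    rewrite avgZ; apply: le_trans (ler_wpM2l _ (avg_final_counter_error w X c)) _.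
      by rewrite invr_ge0 sqr_ge0.
    rewrite -/(true_counter w c) -/t le_eqVlt; apply/orP; left; apply/eqP; field.
    by rewrite !gt_eqF // exprn_gt0.
  by move=> rs; rewrite mulrC.
by rewrite sumr_const card_option card_ord -[leLHS]mulr_natl.
Qed.

Lemma estimate_correct w : penalty w < 1 ->
  `|estimate (tour_state w X (o :: p) 0 [ffun => float_of T kap 0]) - H| <= eps.
Proof.
move=> pen; have m0 := mu_gt0; have L0 := LR_gt0; have e0 := eps_gt0; have e1 := eps_lt1.
have d0 := d_gt0; have d1 := d_le; have dY := dY_le; have F0 : 0 < F%:R :> R by rewrite ltr0n.
have sum_ge0 : 0 <= \sum_c ((final_counter w X c)%:R - (true_counter w.1 c)%:R) ^+ 2 /
           (d * (true_counter w.1 c)%:R) ^+ 2 :> R.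
  by apply: sumr_ge0 => c _; rewrite divr_ge0 ?sqr_ge0.
have smean : `|sample_mean w.1 - mu| <= eps / 16 * mu.
  have em : 0 < eps / 16 * mu by apply: mulr_gt0 => //; apply: divr_gt0.
  rewrite -ler_sqr ?nnegrE ?(ltW em) // real_normK ?num_real //.
  rewrite -[leRHS]mul1r -ler_pdivrMr ?exprn_gt0 //.
  by move: pen; rewrite /penalty; lra.
have cnt c : `|(final_counter w X c)%:R - (true_counter w.1 c)%:R| <=
    d * (true_counter w.1 c)%:R :> R.
  have dt : 0 < d * (true_counter w.1 c)%:R by rewrite mulr_gt0 // ltr0n true_counter_gt0.
  rewrite -ler_sqr ?nnegrE ?(ltW dt) // real_normK ?num_real //.
  rewrite -[leRHS]mul1r -ler_pdivrMr ?exprn_gt0 //.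
  apply: le_trans (ltW pen); rewrite /penalty (bigD1 c) //= addrCA.
  rewrite lerDl addr_ge0 ?divr_ge0 ?sqr_ge0 //.
  by apply: sumr_ge0 => b _; rewrite divr_ge0 ?sqr_ge0.
(* A relative error of at most [d <= 1 / 8] keeps each counter below twice its true value, hence
   within [2 ^ T]. *)
have fit c : float_val (tour_state w X (o :: p) 0 [ffun => float_of T kap 0] c) =
    final_counter w X c.
  apply: tour_state_counter; apply: leq_trans T_ge.
  apply: leq_trans (leq_mul (leqnn 2) (true_counter_le w.1 c)).
  rewrite -(ler_nat R) natrM; have := cnt c; rewrite ler_norml => /andP[_].
  have : d * (true_counter w.1 c)%:R <= 8^-1 * (true_counter w.1 c)%:R :> R.
    by rewrite ler_wpM2r.
  have : 0 <= (true_counter w.1 c)%:R :> R by [].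
  by lra.
rewrite /estimate fit; under eq_bigr do rewrite fit.
have [|r m h] := @mean_expE R A L n A_gt0 L_ge x F_gt0 1; first by rewrite lexx ler1n.
rewrite -/F -/H -/mu in m.
have lnmu : ln mu = - H - ln L%:R - log_gap A 1 + r by rewrite m expRK ln1; ring.
(* Half of [eps] pays for the systematic error of the transform, the other half for sampling and
   rounding. *)
have re : `|r| <= eps / 2.
  by apply: le_trans h _; rewrite mul1r; apply: le_trans eta_F _; lra.
have acc := @estimate_accuracy R 'I_k (fun l => (sketch x (w.1 l))%:R / L%:R / F%:R)
  (fun l => (final_counter w X (Some l))%:R / L%:R / (final_counter w X None)%:R) mu d Y eps.
have {}acc : `|ln ((\sum_(l < k) expR (- ((final_counter w X (Some l))%:R / L%:R /
      (final_counter w X None)%:R))) / k%:R) - ln mu| <= eps / 2.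
  rewrite card_ord in acc; apply: acc => //.
  - exact: ltW.
  - apply: le_trans expY_le _; rewrite ler_wpM2l ?(ltW eps_gt0) //; exact: mu_ge.
  - by move=> l; rewrite !divr_ge0.
  - move=> l; apply: ratio_perturb => //; [exact: ltW|lra|by rewrite divr_ge0| |].
      have := cnt (Some l); rewrite true_counterE => le.
      rewrite -mulrBl normrM [X in _ * X]ger0_norm ?invr_ge0 ?(ltW L0) // mulrA.
      by rewrite ler_wpM2r // invr_ge0 ltW.
    by have := cnt None; rewrite true_counterE.
  - apply: le_trans smean; rewrite le_eqVlt; apply/orP; left; apply/eqP.
    congr (`|_ / _ - _|); apply: eq_bigr => l _; congr expR; congr (- _).
    by field; rewrite !gt_eqF.
rewrite lnmu in acc; move: acc re; set Z := ln (_ / _).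
rewrite !ler_norml => /andP[a1 a2] /andP[r1 r2].
by apply/andP; split; lra.
Qed.

End FixedInput.

Hypothesis B_ge : (((2 ^ kap).+1 * T.+1) ^ k.+1 <= 2 ^ B)%N.

Lemma sketch_protocol :
  exists P : protocol e input R,
    [/\ terminates P,
        forall X r c, reachable (P := P) X r c -> (max_edge_bits e c <= B.*2)%N &
        forall X : V -> input, (0 < \sum_i total X i)%N ->
          2 / 3 <= coin_probability R (outputs_in (P := P) o X (fun h : R =>
            `|h - \sum_i (total X i)%:R / (\sum_j total X j)%N%:R *
               ln (1 / ((total X i)%:R / (\sum_j total X j)%N%:R))| <= eps))].
Proof.
(* [al] bits per jump and [T] bits per rounding. *)
pose cn := (al * (L * n) * k + T * J * k.+1)%N.
have cardO : #|{: cn.-tuple bool}| = #|{: seeds * roundings}|.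
  rewrite card_tuple card_bool card_prod !card_ffun !card_tuple card_option card_prod !card_ord.
  by rewrite /cn expnD !expnM.
have [phi phib] := card_eq_bij cardO.
have cardS : (#|{: state}| <= #|{: B.-tuple bool}|)%N.
  by rewrite card_tuple card_bool card_ffun card_prod card_option !card_ord.
have [enc [dec encK]] := card_le_cancel [ffun => float_of T kap 0] cardS.
pose upd (x : input) (r : cn.-tuple bool) (u : V) (j : nat) (t : B.-tuple bool) :=
  enc (update (phi r) x u j (dec t)).
pose st0 : state := [ffun => float_of T kap 0].
have res X r : dec (tour_result o p upd (enc st0) X r) =
    tour_state (phi r) X (o :: p) 0 st0.
  rewrite /tour_result; move: (o :: p); move: st0 => st.
  suff H rest j : dec (tour_token (fun u => upd (X u) r u) rest j (enc st)) =
    tour_state (phi r) X rest j st by move=> q; exact: H.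
  elim: rest j st => [|v rest IH] j st /=; first by rewrite encK.
  by rewrite {2}/upd encK IH.
pose P := tour_protocol graph_e tour_path upd (enc st0) (fun (_ : cn.-tuple bool) t => estimate (dec t)).
exists P; split.
- exact: tour_terminates.
- by move=> X r c; exact: tour_communication.
move=> X F0; set H := \sum_i _.
have tuple0 : (0 < #|{: cn.-tuple bool}|)%N by rewrite card_tuple card_bool expn_gt0.
have pen0 r : 0 <= penalty X (phi r).
  by rewrite addr_ge0 ?sumr_ge0 // => *; rewrite divr_ge0 ?sqr_ge0.
have avgpen : avg (fun r => penalty X (phi r)) <= 3^-1.
  by rewrite (avg_bij _ phib); exact: avg_penalty F0.
have /= := @markov_avg R _ (fun r : cn.-tuple bool =>
  `[< outputs_in (P := P) o X (fun h : R => `|h - H| <= eps) r >]) _ tuple0 pen0.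
rewrite card_tuple card_bool => mk; apply: le_trans (mk _).
  by move: avgpen; lra.
(* Contrapositive: a penalty below 1 forces a correct output. *)
move=> r /asboolPn nout; rewrite leNgt; apply/negP => lt; apply: nout.
apply: tour_outputs => //; rewrite res.
have E := estimate_correct F0 lt.
apply: le_trans E; rewrite le_eqVlt; apply/orP; left; apply/eqP.
by congr (`|_ - _|).
Qed.

End EntropyProtocol.

(** * Choice of the parameters *)

Section Aggregate.
Variables (R : realType) (m n M : nat) (X : 'I_m -> {ffun 'I_n -> 'I_M.+1}).

Lemma aggregateE i : aggregate R X 0 i = (total X i)%:R.
Proof. by rewrite mxE /total natr_sum. Qed.

Lemma aggregate_neq0 : aggregate R X != 0 -> (0 < \sum_i total X i)%N.
Proof.
apply: contraR; rewrite -eqn0Ngt sum_nat_eq0 => /forallP h.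
apply/eqP/rowP => i; rewrite aggregateE mxE.
by have /implyP/(_ isT)/eqP -> := h i.
Qed.

Lemma shannon_entropy_aggregate : shannon_entropy (aggregate R X) =
  \sum_i (total X i)%:R / (\sum_j total X j)%N%:R *
     ln (1 / ((total X i)%:R / (\sum_j total X j)%N%:R)).
Proof.
rewrite /shannon_entropy natr_sum.
have -> : \sum_j `|aggregate R X 0 j| = \sum_j (total X j)%:R.
  by apply: eq_bigr => j _; rewrite aggregateE normr_nat.
by apply: eq_bigr => i _; rewrite aggregateE normr_nat.
Qed.

End Aggregate.

(** * Logarithms and powers of two *)

Section Logarithms.
Variable R : realType.

Lemma ln2_bounds : (2^-1 <= ln 2 :> R) && (ln 2 <= 1 :> R).
Proof.
apply/andP; split.
  have := @ln_le_subr1 R 2^-1; rewrite invr_gt0 lnV ?posrE // => /(_ (ltr0n _ 2)); lra.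
by have := @ln_le_subr1 R 2 (ltr0n _ 2); lra.
Qed.

(** Keeps [ln (ln n)] away from 0 for [n >= 3], so that additive constants can be absorbed. *)
Lemma ln_ln3_gt0 : 0 < ln (ln 3) :> R.
Proof.
apply: ln_gt0; rewrite -[ltLHS]expRK ltr_ln ?posrE ?expR_gt0 //.
(* [expR 1 < 3] will follow from [(6 / 5) ^+ 6 < 3]. *)
have h : expR 6^-1 <= 6 / 5 :> R.
  have := expR_ge1Dx (- 6^-1 : R); rewrite expRN => h.
  have : (expR 6^-1)^-1^-1 <= (5 / 6)^-1 :> R.
    by rewrite lef_pV2 ?posrE ?invr_gt0 ?expR_gt0 ?divr_gt0 //; lra.
  by rewrite invrK invf_div.
rewrite [X in expR X < _](_ : 1 = 6%:R * 6^-1); last by field.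
rewrite expRM_natl; apply: (@le_lt_trans _ _ ((6 / 5) ^+ 6)).
  by rewrite lerXn2r ?nnegrE ?expR_ge0 ?divr_ge0.
by lra.
Qed.

Lemma pow2_ln_le (j : nat) (x : R) : 2 ^+ j <= x -> j%:R <= 2 * ln x.
Proof.
move=> jx; have /andP[l1 _] := ln2_bounds.
have x0 : 0 < x by apply: lt_le_trans jx; rewrite exprn_gt0.
have : ln (2 ^+ j) <= ln x by rewrite ler_ln ?posrE ?exprn_gt0.
rewrite lnXn // -[ln 2 *+ j]mulr_natl => h.
have : j%:R * 2^-1 <= j%:R * ln 2 :> R by rewrite ler_wpM2l.
by lra.
Qed.

Lemma up_log_le (j : nat) : (0 < j)%N -> (2 ^ up_log 2 j <= 2 * j)%N.
Proof.
move=> j0; have [j1|j1] := leqP j 1; first by have -> : j = 1%N by lia.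
have /andP[h _] := up_log_bounds (isT : (1 < 2)%N) j1.
have u0 : (0 < up_log 2 j)%N by rewrite up_log_gt0.
by rewrite -(prednK u0) expnS leq_mul2l /= ltnW.
Qed.

Lemma log_log_le n : (3 <= n)%N ->
  (up_log 2 (up_log 2 n))%:R <= 6 + 2 * ln (ln n%:R) :> R.
Proof.
move=> n3; set a := up_log 2 n.
have n0 : 0 < n%:R :> R by rewrite ltr0n; lia.
have a0 : (0 < a)%N by rewrite up_log_gt0; lia.
have lnn : 0 < ln n%:R :> R by rewrite ln_gt0 // ltr1n; lia.
have h1 : a%:R <= 4 * ln n%:R :> R.
  (* Here [2 ^ a <= 2 * n <= n ^ 2]. *)
  have := @pow2_ln_le a (n%:R ^+ 2).
  rewrite lnXn // -[ln _ *+ 2]mulr_natl -!natrX ler_nat => h.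
  have : a%:R <= 2 * (2 * ln n%:R) :> R.
    apply: h; apply: leq_trans (up_log_le _) _; first by lia.
    by rewrite expnS expn1 leq_mul2r; lia.
  by lra.
have h2 := @pow2_ln_le (up_log 2 a) (8 * ln n%:R).
have ln8 : ln 8 = 3 * ln 2 :> R.
  by rewrite -[8]/(8%N%:R) -[8%N]/(2 ^ 3)%N natrX lnXn // -[LHS]mulr_natl.
have /andP[_ l2] := ln2_bounds.
rewrite lnM ?posrE // ln8 in h2.
suff : (up_log 2 a)%:R <= 2 * (3 * ln 2 + ln (ln n%:R)) :> R by lra.
apply: h2; rewrite -natrX; apply: (@le_trans _ _ (2 * a)%:R).
  by rewrite ler_nat up_log_le.
by rewrite natrM; lra.
Qed.

(** Rounds [1 / eps] up to a power of two, so that the parameters can be powers of two. *)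
Lemma inv_pow2_bounds (eps : R) : 0 < eps -> eps < 1 ->
  exists2 q : nat, 1 <= eps * 2 ^+ q & eps * 2 ^+ q <= 2.
Proof.
move=> e0 e1; pose P q := 1 <= eps * 2 ^+ q.
have exP : exists q, P q.
  have [j hj] : exists j : nat, eps^-1 <= j%:R.
    by exists (Num.bound eps^-1); rewrite ltW // archi_boundP // invr_ge0 ltW.
  exists j; rewrite /P -ler_pdivrMl // mulr1 (le_trans hj) //.
  by rewrite -natrX ler_nat ltnW // ltn_expl.
have [[|q] hq mq] := ex_minnP exP; first by exists 0%N; rewrite // expr0; lra.
exists q.+1 => //; have : ~~ P q by apply/negP => /mq; rewrite ltnn.
by rewrite /P -ltNge exprS; lra.
Qed.

End Logarithms.

(** A quantity linear in [a], itself of order [ln n], has a logarithm of order [ln (ln n)]; this is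
    the source of the double logarithm. *)
Lemma log_poly_bound (a q u v w : nat) : (2 <= a)%N ->
  (u + v * a + w * q <= 2 ^ (u + v + w + up_log 2 a + q))%N.
Proof.
move=> a2; rewrite !expnD.
have h1 : (a <= 2 ^ up_log 2 a)%N by apply: up_logP.
have h2 : (q < 2 ^ q)%N by apply: ltn_expl.
have hu : (u < 2 ^ u)%N by apply: ltn_expl.
have hv : (v < 2 ^ v)%N by apply: ltn_expl.
have hw : (w < 2 ^ w)%N by apply: ltn_expl.
move: (2 ^ u)%N (2 ^ v)%N (2 ^ w)%N (2 ^ _)%N (2 ^ q)%N h1 h2 hu hv hw => U V W P Q *.
apply: (@leq_trans ((u + v + w) * (P * Q))).
  rewrite !mulnDl !leq_add // ?leq_mul //; first by rewrite leq_pmulr // muln_gt0; lia.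
    by apply: leq_trans (leq_pmulr _ _); lia.
  by apply: leq_trans (leq_pmull _ _); lia.
rewrite -[(_ * P * Q)%N]mulnA leq_mul2r; apply/orP; right.
apply: (@leq_trans (u.+1 * v.+1 * w.+1)); last by rewrite !leq_mul.
by clear; nia.
Qed.

(** [2 ^+ (2 * q)] is at most [4 / eps ^+ 2], and [G >= g > 0] lets [9 / g * G] absorb the constant
    9. *)
Lemma bits_bound (R : realType) (q la k B C3 : nat) (eps g G : R) :
  0 < eps -> eps * 2 ^+ q <= 2 -> k = (2 ^ (2 * q + 14))%N ->
  (B <= k.+1 * (C3 * (1 + q + la)))%N ->
  0 < g -> g <= G -> (1 + q + la)%:R <= 9 + 2 * G ->
  B.*2%:R <= 2 ^+ 18 * C3%:R * (9 / g + 2) / eps ^+ 2 * G.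
Proof.
move=> e0 eq kE le g0 gG hG.
have G9 : 9 + 2 * G <= (9 / g + 2) * G.
  have : 9 <= 9 * (g^-1 * G).
    by rewrite -[leLHS]mulr1 ler_pM2l // mulrC ler_pdivlMr // mul1r.
  by lra.
have q4 : 2 ^+ (2 * q) <= 4 / eps ^+ 2 :> R.
  rewrite ler_pdivlMr ?exprn_gt0 // mulnC exprM -exprMn mulrC.
  have -> : 4 = 2 ^+ 2 :> R by rewrite -natrX.
  by rewrite lerXn2r ?nnegrE // mulr_ge0 ?exprn_ge0 // ltW.
have k1 : k.+1%:R <= 2 ^+ 15 * 2 ^+ (2 * q) :> R.
  rewrite -!natrX -natrM ler_nat kE -expnD.
  rewrite (_ : (15 + 2 * q)%N = (2 * q + 14).+1) ?expnS ?mul2n -?addnn; last by lia.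
  by rewrite -addn1 leq_add2l expn_gt0.
rewrite -muln2 natrM.
have B1 : B%:R <= k.+1%:R * (C3%:R * (1 + q + la)%:R) :> R.
  by rewrite -!natrM ler_nat.
have B2 : k.+1%:R * (C3%:R * (1 + q + la)%:R) <=
    2 ^+ 15 * (4 / eps ^+ 2) * (C3%:R * ((9 / g + 2) * G)) :> R.
  apply: ler_pM; rewrite ?mulr_ge0 ?ler0n //.
    by apply: le_trans k1 _; rewrite ler_wpM2l ?exprn_ge0.
  by rewrite ler_wpM2l ?ler0n // (le_trans hG).
have -> : 2 ^+ 18 * C3%:R * (9 / g + 2) / eps ^+ 2 * G =
    2 ^+ 15 * (4 / eps ^+ 2) * (C3%:R * ((9 / g + 2) * G)) * 2 by field; rewrite !gt_eqF.
by rewrite ler_wpM2r // (le_trans B1).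
Qed.

Lemma expr_cancel_sqr (F : fieldType) (x : F) j w : x != 0 ->
  x * (x ^+ j) ^+ 2 / x ^+ (2 * j + 1 + w) = x ^- w.
Proof.
move=> x0; rewrite (exprD _ _ w) (exprD _ _ 1) mulnC exprM expr1; field.
by rewrite x0 !expf_neq0.
Qed.

Theorem theorem26 (R : realType) (K c : nat) :
  exists2 C : R, 0 < C &
  forall (n m M : nat) (eps : R) (e : rel 'I_m) (o : 'I_m),
    (3 <= n)%N -> (m <= K * n ^ c)%N -> (M <= K * n ^ c)%N ->
    0 < eps < 1 ->
    connected_graph e ->
    exists P : protocol e {ffun 'I_n -> 'I_M.+1} R,
      [/\ terminates P,
          uses_max_communication P
            (C / eps ^+ 2 * (ln (ln n%:R) + ln (1 / eps))) &
          forall X : 'I_m -> {ffun 'I_n -> 'I_M.+1},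
            aggregate R X != 0 ->
            2 / 3 <= coin_probability R
              (outputs_in (P := P) o X
                (fun H => `|H - shannon_entropy (aggregate R X)| <= eps))].
Proof.
have g0 := ln_ln3_gt0 R; set g := ln (ln 3) in g0.
(* One counter will take [C3 + 7 * q + 3 * la] bits. *)
pose C3 := (197 + 10 * K + 10 * c)%N.
exists (2 ^+ 18 * C3%:R * (9 / g + 2)).
  by rewrite !mulr_gt0 ?exprn_gt0 ?ltr0n ?addr_gt0 ?divr_gt0.
move=> n m M eps e o n3 mK MK /andP[e0 e1] graph_e.
have [p [tp tc tu ta]] := closed_tour o graph_e.
have [q q1 q2] := inv_pow2_bounds e0 e1.
pose a := up_log 2 n; pose la := up_log 2 a.
have na : (n <= 2 ^ a)%N by apply: up_logP.
have a2 : (2 <= a)%N.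
  rewrite ltnNge; apply/negP => a1.
  by have : (2 ^ a <= 2 ^ 1)%N; [rewrite leq_exp2l|lia].
have [nu nuE] : exists nu, nu = (2 * K + (2 * c + 1) * a)%N by eexists.
(* [2 ^ w] is at least [2048 / eps]; [l] and [al] are chosen so that the two terms of the sketch
   error become [65 * 2 ^- w] and [2 ^- w]. *)
have [w wE] : exists w, w = (q + 11)%N by eexists.
have [l lE] : exists l, l = (2 * w + 1)%N by eexists.
have [al alE] : exists al, al = (2 * (l + nu) + 1 + w)%N by eexists.
have [k kE] : exists k, k = (2 ^ (2 * q + 14))%N by eexists.
(* With [Y = 2 * yy], [expR (- (Y / 2)) <= 2 ^- yy]; the 7 pays for the factors 16 and 8, and [q]
   for [eps]. *)
have [yy yyE] : exists yy, yy = (q + 7 + nu + l)%N by eexists.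
have [ly lyE] : exists ly, ly = (34 + 2 * K + 2 * c + la + q)%N by eexists.
(* With [d = 2 ^- D], the 8 pays for [128 * 2], [ly] for [yy] and [q] for [eps]. *)
have [D DE] : exists D, D = (8 + ly + q)%N by eexists.
(* [2 * D] cancels [d ^+ 2], and [2 * q + 19] outweighs the [k.+1] counters. *)
have [kap kapE] : exists kap, kap = (2 * q + 19 + 2 * D)%N by eexists.
have [T TE] : exists T, T = (1 + (nu + (l + al)))%N by eexists.
have [lt ltE] : exists lt, lt = (93 + 6 * K + 6 * c + la + q)%N by eexists.
(* Per counter, [kap + 1] bits for the mantissa and [lt] for the exponent. *)
have [B BE] : exists B, B = (k.+1 * (kap + 1 + lt))%N by eexists.
have two0 j : 0 < 2 ^+ j :> R by rewrite exprn_gt0.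
have yy_le : (yy <= 2 ^ ly)%N.
  apply: leq_trans (_ : 30 + 2 * K + (2 * c + 1) * a + 3 * q <= _)%N.
    by rewrite yyE nuE lE wE; clear; lia.
  apply: leq_trans (log_poly_bound _ _ _ _ a2) _.
  by rewrite leq_exp2l // lyE /la; clear; lia.
have T_le : (T.+1 <= 2 ^ lt)%N.
  apply: leq_trans (_ : 83 + 6 * K + (6 * c + 3) * a + 7 * q <= _)%N.
    by rewrite TE alE nuE lE wE; clear; lia.
  apply: leq_trans (log_poly_bound _ _ _ _ a2) _.
  by rewrite leq_exp2l // ltE /la; clear; lia.
have N_ge : (#|'I_m| * n * M <= 2 ^ nu)%N.
  have Kn : (K * n ^ c <= 2 ^ (K + c * a))%N.
    rewrite expnD leq_mul ?(ltnW (ltn_expl _ _)) // mulnC expnM.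
    by case: (c) => [|c']; rewrite ?expn0 // leq_exp2r.
  rewrite card_ord (_ : nu = (K + c * a) + a + (K + c * a))%N; last by rewrite nuE; clear; lia.
  rewrite expnD [(2 ^ (_ + a))%N]expnD; apply: leq_mul; last exact: leq_trans MK Kn.
  by apply: leq_mul => //; exact: leq_trans mK Kn.
have natX j : (2 ^ j)%N%:R = 2 ^+ j :> R by rewrite natrX.
have w1 : 2048 <= eps * 2 ^+ w.
  rewrite wE exprD mulrA; have -> : 2 ^+ 11 = 2048 :> R by rewrite -natrX.
  by rewrite -[leLHS]mul1r ler_pM2r.
have eta_le : 65 * Num.sqrt (2 / (2 ^ l)%N%:R) +
    2 * ((2 ^ l)%N%:R * (2 ^ nu)%N%:R) ^+ 2 / (2 ^ al)%N%:R <= eps / 8 :> R.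
  rewrite !natX -exprD.
  have -> : 2 / 2 ^+ l = (2 ^- w) ^+ 2 :> R.
    rewrite lE exprD mulnC exprM expr1; field.
    by rewrite gt_eqF.
  rewrite sqrtr_sqr ger0_norm ?invr_ge0 ?exprn_ge0 //.
  have -> : 2 * (2 ^+ (l + nu)) ^+ 2 / 2 ^+ al = 2 ^- w :> R.
    by rewrite alE; apply: expr_cancel_sqr; rewrite gt_eqF.
  have : (2 ^- w) * 2048 <= eps :> R by rewrite mulrC ler_pdivrMr.
  by have : 0 <= 2 ^- w :> R; [rewrite invr_ge0 exprn_ge0|lra].
have d0 : 0 < 2 ^- D :> R by rewrite invr_gt0.
have d8 : 2 ^- D <= 8^-1 :> R.
  have -> : 8 = 2 ^+ 3 :> R by rewrite -natrX.
  rewrite lef_pV2 ?posrE // ler_eXn2l ?ltr1n //.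
  by rewrite DE; clear; lia.
have dY : 128 * 2 ^- D * (2 * yy%:R) <= eps :> R.
  apply: (@le_trans _ _ (2 ^- q)); last first.
    by rewrite -[leLHS]mul1r ler_pdivrMr.
  have y1 : yy%:R <= 2 ^+ ly :> R by rewrite -natX ler_nat.
  have -> : 2 ^- q = 128 * 2 ^- D * (2 * 2 ^+ ly) :> R.
    by rewrite DE !exprD; field; rewrite !gt_eqF.
  by rewrite ler_wpM2l ?mulr_ge0 ?(ltW d0) // ler_wpM2l.
have eY : 16 * expR (- (2 * yy%:R / 2)) <= eps * (8 * (2 ^ nu)%N%:R * (2 ^ l)%N%:R)^-1 :> R.
  have -> : 2 * yy%:R / 2 = yy%:R * 1 :> R by field.
  rewrite -mulrN expRM_natl !natX.
  have h2 : expR (- 1) <= 2^-1 :> R.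
    rewrite expRN lef_pV2 ?posrE ?expR_gt0 //.
    by apply: le_trans (expR_ge1Dx _); rewrite -[2]/(1 + 1).
  apply: (@le_trans _ _ (16 * 2^-1 ^+ yy)).
    by rewrite ler_wpM2l // lerXn2r ?nnegrE ?expR_ge0 ?invr_ge0.
  rewrite ler_pdivlMr ?mulr_gt0 //.
  have -> : 16 * 2^-1 ^+ yy * (8 * 2 ^+ nu * 2 ^+ l) = 2 ^- q :> R.
    by rewrite yyE exprVn !exprD; field; rewrite !gt_eqF.
  by rewrite -[leLHS]mul1r ler_pdivrMr.
have k_ge : 8 / ((k%:R : R) * (eps / 16) ^+ 2) <= 6^-1.
  have -> : k%:R * (eps / 16) ^+ 2 = 64 * (eps * 2 ^+ q) ^+ 2 :> R.
    rewrite kE natX exprD exprM exprMn.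
    have -> : 2 ^+ 14 = 16384 :> R by rewrite -natrX.
    by field.
  have sq : 1 <= (eps * 2 ^+ q) ^+ 2 by rewrite exprn_ege1.
  by rewrite ler_pdivrMr; lra.
have kap_ge : k.+1%:R * (2 / (2 ^+ kap * (2 ^- D) ^+ 2)) <= 6^-1 :> R.
  have -> : 2 ^+ kap * (2 ^- D) ^+ 2 = 2 ^+ (2 * q) * 2 ^+ 19 :> R.
    by rewrite kapE [in X in X * _]exprD exprD [(2 * D)%N]mulnC [2 ^+ (D * 2)]exprM; field; rewrite gt_eqF.
  have k1 : k.+1%:R <= 2 ^+ (2 * q) * 2 ^+ 15 :> R.
    rewrite -exprD -natX ler_nat kE (_ : (2 * q + 15)%N = (2 * q + 14).+1); last by clear; lia.
    have : (0 < 2 ^ (2 * q + 14))%N by rewrite expn_gt0.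
    by rewrite expnS; move: (2 ^ _)%N => z; clear; lia.
  have -> : 2 ^+ 19 = 2 ^+ 15 * 16 :> R.
    by rewrite -[19%N]/(15 + 4)%N exprD; congr (_ * _); rewrite -natrX.
  rewrite mulrA ler_pdivrMr ?mulr_gt0 //.
  have : 0 < 2 ^+ (2 * q) * 2 ^+ 15 :> R by rewrite mulr_gt0.
  by lra.
have B_ge : (((2 ^ kap).+1 * T.+1) ^ k.+1 <= 2 ^ B)%N.
  rewrite BE [(k.+1 * _)%N]mulnC expnM leq_exp2r // expnD leq_mul // addn1 expnS.
  have : (0 < 2 ^ kap)%N by rewrite expn_gt0.
  by move: (2 ^ _)%N => z; clear; lia.
have kap0 : (0 < kap)%N by rewrite kapE; clear; lia.
have k0 : (0 < k)%N by rewrite kE expn_gt0.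
have L512 : (512 <= 2 ^ l)%N.
  by rewrite (_ : 512 = 2 ^ 9)%N // leq_exp2l // lE wE; clear; lia.
have T_ge : (2 * (2 ^ nu * (2 ^ l * 2 ^ al)) <= 2 ^ T)%N by rewrite TE !expnD expn1.
have Y0 : 0 <= 2 * yy%:R :> R by rewrite mulr_ge0.
have [P [P1 P2 P3]] := @sketch_protocol R _ e o p n M k (2 ^ l) al T kap B (2 ^ nu)
  (2 ^- D) (2 * yy%:R) eps graph_e tp tc tu ta kap0 k0 L512 N_ge e0 e1 d0 d8 Y0 eta_le
  dY eY T_ge k_ge kap_ge B_ge.
exists P; split => //; last first.
  by move=> X X0; rewrite shannon_entropy_aggregate; exact: P3 (aggregate_neq0 X0).
move=> X r cf rc; have {}P2 : (max_edge_bits e cf)%:R <= B.*2%:R :> R.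
  by rewrite ler_nat (P2 X r).
apply: le_trans P2 _; apply: (@bits_bound R q la k B C3) => //.
- rewrite BE leq_mul2l; apply/orP; right.
  apply: leq_trans (_ : C3 * 1 + 7 * q + 3 * la <= _)%N.
    by rewrite kapE DE lyE ltE /C3; clear; lia.
  have C37 : (7 <= C3)%N by rewrite /C3; clear; lia.
  rewrite 2!mulnDr; apply: leq_add; first apply: leq_add => //.
    by rewrite leq_mul2r C37 orbT.
  by rewrite leq_mul2r (leq_trans _ C37) ?orbT.
- rewrite -[leLHS]addr0 lerD //.
    rewrite ler_ln ?posrE ?ln_gt0 ?ltr1n //; last by apply: leq_trans n3.
    by rewrite ler_ln ?posrE ?ltr0n ?ler_nat //; apply: leq_trans n3.
  by rewrite ln_ge0 // div1r -[leLHS]invr1 lef_pV2 ?posrE // ltW.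
(* The constants are 1, the 6 of [log_log_le] and the [2 * ln 2] from [q <= 2 * ln (2 / eps)]; they
   add up to at most 9. *)
- have /andP[_ l2] := ln2_bounds R.
  have h1 := log_log_le R n3.
  have h2 : q%:R <= 2 * ln (2 / eps) :> R.
    by apply: pow2_ln_le; rewrite ler_pdivlMr // mulrC.
  rewrite ln_div ?posrE // in h2.
  rewrite div1r lnV ?posrE // !natrD.
  move: h1 h2 l2; rewrite -/a -/la; clear; lra.
Qed.
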